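(* Let $L$ be the operator generated by $Ly=\frac1r\left(-(y^{[1]})'+sy^{[1]}+qy\right)$, $y^{[1]}=p(y'+sy)$, on $(a,b)$ and a self-adjoint boundary condition $AY(a)+BY(b)=0$. For $m\in\mathbb N$ let $L_m$ be the operator generated by the same expression and the same boundary condition (same $A$, $B$ and $r$) with the coefficients $p,q,s$ replaced by $p_m,q_m,s_m$ respectively (also in the quasi-derivative), where $p_m,q_m,s_m$ are real-valued, $1/p_m,q_m,s_m\in L^1(J,\mathbb R)$ and $p_m>0$ a.e. on $J$. If $$\|1/p_m-1/p\|_1\to0,\qquad\|q_m-q\|_1\to0,\qquad\|s_m-s\|_1\to0\qquad\text{as }m\to\infty,$$ then $L_m$ converges to $L$ in the sense of norm resolvent convergence.
   Context: Let $J=(a,b)$ with $-\infty<a<b<\infty$, and let $p,q,r,s$ be real-valued functions on $J$ with $1/p,q,r,s\in L^1(J,\mathbb R)$, $p>0$ and $r>0$ a.e. on $J$; $\|\cdot\|_1$ is the $L^1(J)$ norm. $Y=(y,y^{[1]})^T$. Self-adjoint boundary condition: $A,B$ are complex $2\times2$ matrices with $(A|B)$ of rank $2$ and $AEA^*=BEB^*$, $E=\begin{pmatrix}0&-1\\1&0\end{pmatrix}$. The operator generated by the expression and the boundary condition acts in the weighted space $L^2_r(J)$ (norm $(\int_a^b|f|^2r)^{1/2}$) on the domain of all $y$ with $y,y^{[1]}$ absolutely continuous on $[a,b]$, $y$ satisfying the boundary condition, and $Ly\in L^2_r(J)$; it is self-adjoint. Closed operators $T_m$ converge to a closed operator $T$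 in the sense of norm resolvent convergence if there is $\mu\in\mathbb C$ belonging to the resolvent sets of $T$ and of $T_m$ for all sufficiently large $m$ such that $(T_m-\mu)^{-1}\to(T-\mu)^{-1}$ in operator norm. *)

(* Defs.v *)
From HB Require Import structures.
From mathcomp Require Import all_boot all_order all_algebra.
From mathcomp Require Import all_classical all_reals all_analysis.
From mathcomp.real_closed Require Import complex.

Set Implicit Arguments.
Unset Strict Implicit.
Unset Printing Implicit Defensive.

Import Order.TTheory GRing.Theory Num.Theory.
Import numFieldNormedType.Exports.

Local Open Scope classical_set_scope.
Local Open Scope ring_scope.
Local Open Scope complex_scope.

(* Functions on J = (a, b) are represented by total functions on R; only their
   values on J (on [a, b] for absolutely continuous functions) matter.
   Measurability is Borel measurability: every Lebesgue-measurable function is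
   a.e. equal to a Borel one, so the spaces L^1(J) and L^2_r(J) are the usual
   ones. *)

Section L1.
Context {R : realType}.
Local Notation mu := (@lebesgue_measure R).

Definition inL1 (a b : R) (f : R -> R) : Prop :=
  mu.-integrable `]a, b[ (EFin \o f).

Definition L1norm (a b : R) (f : R -> R) : \bar R :=
  (\int[mu]_(x in `]a, b[) `|f x|%:E)%E.

Definition ae_pos (a b : R) (f : R -> R) : Prop :=
  {ae mu, forall x, x \in `]a, b[ -> 0 < f x}.

End L1.

Section AbsolutelyContinuous.
Context {R : realType}.

Definition abs_continuous (a b : R) (f : R -> R[i]) : Prop :=
  forall e : R, 0 < e -> exists2 d : R, 0 < d &
    forall (n : nat) (u v : 'I_n -> R),
      (forall i, a <= u i /\ u i <= v i /\ v i <= b) ->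
      trivIset setT (fun i => `]u i, v i[%classic) ->
      \sum_(i < n) (v i - u i) < d ->
      \sum_(i < n) Normc.normc (f (v i) - f (u i)) < e.

(* The derivative of a complex-valued function of a real variable.  It is a
   total function, with unspecified values where f is not differentiable; an
   absolutely continuous f is differentiable a.e. *)
Definition cderiv (f : R -> R[i]) (x : R) : R[i] :=
  derive1 (fun t : R => complex.Re (f t)) x +i*
  derive1 (fun t : R => complex.Im (f t)) x.

End AbsolutelyContinuous.

Section OperatorsInL2r.
Context {R : realType}.
Local Notation mu := (@lebesgue_measure R).
Variables (a b : R) (r : R -> R).

Definition inL2r (f : R -> R[i]) : Prop :=
  [/\ measurable_fun `]a, b[ (fun x => complex.Re (f x)),
      measurable_fun `]a, b[ (fun x => complex.Im (f x)) &
      (\int[mu]_(x in `]a, b[) (Normc.normc (f x) ^+ 2 * r x)%:E < +oo)%E].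

Definition L2r_norm (f : R -> R[i]) : R :=
  Num.sqrt (\int[mu]_(x in `]a, b[) (Normc.normc (f x) ^+ 2 * r x)).

(* An operator in L^2_r(J) is represented by its graph: a set of pairs of
   elements of L^2_r(J), invariant under a.e. modification within it.  Since r > 0
   a.e., a.e. for r dx and for dx are the same. *)
Definition graph := set ((R -> R[i]) * (R -> R[i])).

(* The graph of (T - z)^-1. *)
Definition resolvent (T : graph) (z : R[i]) : graph :=
  [set hf | inL2r hf.1 /\ exists2 g, T (hf.2, g) &
     hf.1 = (fun x => g x - z * hf.2 x) %[ae mu in `]a, b[%classic]].

Definition graph_sub (S T : graph) : graph :=
  [set k | exists f g, [/\ S (k.1, f), T (k.1, g) & k.2 = f \- g]].

Definition opnorm (S : graph) : \bar R :=
  ereal_sup [set (L2r_norm k.2)%:E | k in [set k | S k /\ L2r_norm k.1 <= 1]].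

(* T - z is onto L^2_r(J) and one-to-one, with bounded inverse. *)
Definition in_resolvent_set (T : graph) (z : R[i]) : Prop :=
  [/\ forall h, inL2r h -> exists f, resolvent T z (h, f),
      forall h f1 f2, resolvent T z (h, f1) -> resolvent T z (h, f2) ->
        f1 = f2 %[ae mu in `]a, b[%classic] &
      (opnorm (resolvent T z) < +oo)%E].

Definition norm_resolvent_cvg (T_ : nat -> graph) (T : graph) : Prop :=
  exists z : R[i],
    [/\ in_resolvent_set T z,
        \forall m \near \oo, in_resolvent_set (T_ m) z &
        opnorm (graph_sub (resolvent (T_ m) z) (resolvent T z))
          @[m --> \oo] --> (0 : \bar R)%E].

End OperatorsInL2r.

Section SturmLiouville.
Context {R : realType}.
Local Notation mu := (@lebesgue_measure R).

Definition symplectic_mx : 'M[R[i]]_2 := delta_mx 1 0 - delta_mx 0 1.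

Definition adjoint_mx (A : 'M[R[i]]_2) : 'M[R[i]]_2 :=
  map_mx (fun z : R[i] => z^*) A^T.

Definition selfadjoint_bc (A B : 'M[R[i]]_2) : Prop :=
  \rank (row_mx A B) = 2%N /\
  A *m symplectic_mx *m adjoint_mx A = B *m symplectic_mx *m adjoint_mx B.

Definition quasi_deriv (p s : R -> R) (y : R -> R[i]) (x : R) : R[i] :=
  (p x)%:C * (cderiv y x + (s x)%:C * y x).

(* The second argument u stands for y^[1]. *)
Definition sl_expr (q r s : R -> R) (y u : R -> R[i]) (x : R) : R[i] :=
  ((r x)^-1)%:C * (- cderiv u x + (s x)%:C * u x + (q x)%:C * y x).

Definition vec2 (z w : R[i]) : 'cV[R[i]]_2 :=
  \col_(i < 2) (if i == ord0 then z else w).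

(* y^[1] is only defined a.e.; u is its absolutely continuous representative
   on [a, b], which also gives the meaning of y^[1] at a and b. *)
Definition sl_operator (a b : R) (p q r s : R -> R) (A B : 'M[R[i]]_2) :
    graph :=
  [set fg | [/\ inL2r a b r fg.1, inL2r a b r fg.2 & exists y u,
     [/\ abs_continuous a b y /\ abs_continuous a b u,
         u = quasi_deriv p s y %[ae mu in `]a, b[%classic],
         A *m vec2 (y a) (u a) + B *m vec2 (y b) (u b) = 0,
         fg.1 = y %[ae mu in `]a, b[%classic] &
         fg.2 = sl_expr q r s y u %[ae mu in `]a, b[%classic]]]].

End SturmLiouville.

(* Main.v *)
(* At the spectral parameter 'i, the resolvent equation (L - 'i) y = h is the
   first-order system y' = - s y + u / p, u' = (q - 'i r) y + s u - r h with
   integrable coefficients, together with the boundary condition.  Its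
   homogeneous form has only the zero solution, because 'i is not real and the
   boundary condition is self-adjoint; hence it is solvable for every h, with an
   a priori bound sup (|y| + |u|) <= K |r h|_1.  If (y, u) and (y_m, u_m) solve
   the problems of L and L_m for the same h, their difference solves that of L
   with a forcing term (M - M_m) (y_m, u_m), where the matrices M and M_m of the
   systems differ by eps_m -> 0 in L^1.  The a priori bound for L alone then
   gives the unique solvability for L_m as soon as K eps_m <= 1/2, and
   sup |y - y_m| <= 2 K^2 eps_m |r h|_1.  As |r h|_1 is bounded when h runs over
   the unit ball of L^2_r, and the L^2_r norm is at most sqrt |r|_1 times the sup
   norm, this is norm resolvent convergence.

   Absolutely continuous functions are the primitives of integrable functions:
   the total variation of an absolutely continuous function defines a
   Lebesgue-Stieltjes measure dominated by the Lebesgue measure, to which the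
   Radon-Nikodym theorem applies. *)
From HB Require Import structures.
Require Import Defs.
From mathcomp Require Import all_boot all_order all_algebra.
From mathcomp Require Import all_classical all_reals all_analysis.
From mathcomp.real_closed Require Import complex.
From mathcomp Require Import measurable_realfun ring lra.
Set Implicit Arguments.
Unset Strict Implicit.
Unset Printing Implicit Defensive.
Import Order.TTheory GRing.Theory Num.Theory.
Import numFieldNormedType.Exports.
Local Open Scope classical_set_scope.
Local Open Scope ring_scope.
(** * Absolutely continuous functions *)

(** Two forms of absolute continuity have to be reconciled: the domain of the operator uses an
    epsilon-delta condition, whereas uniqueness, bounds and perturbation live on integral equations.
    [primitive] is the working form, and passing to and from it is what turns an element of the
    graph into a solution of a system, and back. A complex pair is split into four real functions,
    so that all integrals are real and the boundary condition becomes a real one with 4 by 4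
    matrices. Since the coefficients are merely integrable, neither Lipschitz bounds in [t] nor a
    short interval is available. A sup norm with an exponential weight replaces them: integration
    against the norm of the coefficient matrix then contracts by 1/2 on the whole interval, which
    serves both Picard iteration and the Gronwall bound. The threshold 1/2 for [K * eps] has the
    same purpose: in each case a quantity bounded by a constant plus half its own supremum is at
    most twice the constant, and this is where the factors 2 come from. The perturbed coefficients
    enter the estimates only through the single number [eps]. *)

Section AbsolutelyContinuousFunctions.
Context {R : realType}.
Local Notation mu := (@lebesgue_measure R).
Implicit Types (a b x y : R) (f g : R -> R) (l : seq (R * R)).

Definition increasing_itvs a b l :=
  all (fun z => [&& a <= z.1, z.1 <= z.2 & z.2 <= b]) l &&
  pairwise (fun z w => z.2 <= w.1) l.

(* Absolute continuity, tested on increasing lists of intervals: these can be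
   refined by replacing an interval with the list of steps of a partition. *)
Definition ac a b f := forall e : R, 0 < e -> exists2 d : R, 0 < d &
  forall l, increasing_itvs a b l -> \sum_(z <- l) (z.2 - z.1) < d ->
    \sum_(z <- l) `|f z.2 - f z.1| <= e.

Lemma increasing_itvs_trivIset a b l : increasing_itvs a b l ->
  trivIset setT (fun i : 'I_(size l) =>
    `](nth (0, 0) l i).1, (nth (0, 0) l i).2[%classic).
Proof.
move=> /andP[_ /(pairwiseP (0, 0)) lp].
have H (i j : 'I_(size l)) : (i < j)%N ->
    `](nth (0, 0) l i).1, (nth (0, 0) l i).2[ `&`
    `](nth (0, 0) l j).1, (nth (0, 0) l j).2[ = set0.
  move=> ij; rewrite -subset0 => t [] /=; rewrite !in_itv/= => /andP[_ t1] /andP[t2 _].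
  have := lp _ _ (ltn_ord i) (ltn_ord j) ij.
  by rewrite leNgt (lt_trans t2 t1).
move=> i j _ _ [t it]; apply/val_inj; have [ij|ij|//] := ltngtP i j.
  by have := H _ _ ij; rewrite -subset0 => /(_ t it).
by have := H _ _ ij; rewrite -subset0 => /(_ t); case: it => ? ?; case.
Qed.

Lemma acP a b f : (forall e : R, 0 < e -> exists2 d : R, 0 < d &
    forall (n : nat) (u v : 'I_n -> R),
      (forall i, a <= u i /\ u i <= v i /\ v i <= b) ->
      trivIset setT (fun i => `]u i, v i[%classic) ->
      \sum_(i < n) (v i - u i) < d ->
      \sum_(i < n) `|f (v i) - f (u i)| < e) -> ac a b f.
Proof.
move=> H e e0; have [d d0 {}H] := H e e0; exists d => // l lab.
rewrite !(big_nth (0, 0)) !big_mkord => ld; apply/ltW; apply: H => //.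
  move=> i; have /andP[/all_nthP - /(_ (0, 0) i (ltn_ord i)) /and3P[? ? ?] _] := lab.
  by [].
exact: increasing_itvs_trivIset lab.
Qed.

(** * Total variation of an absolutely continuous function *)

Definition steps x (s : seq R) := zip (x :: s) s.

Lemma steps_cons x y s : steps x (y :: s) = (x, y) :: steps y s.
Proof. by []. Qed.

Lemma steps_in x y s z : itv_partition x y s -> z \in steps x s ->
  [&& x <= z.1, z.1 <= z.2 & z.2 <= y].
Proof.
elim: s x => [//|w s IH] x [/= /andP[xw ws] sy].
rewrite steps_cons inE => /orP[/eqP ->|zs] /=.
  rewrite lexx (ltW xw)/=; exact: (itv_partition_le (conj ws sy)).
have /and3P[h1 -> ->] := IH w (conj ws sy) zs.
by rewrite (le_trans (ltW xw) h1).
Qed.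

Lemma increasing_itvs_steps x y s : itv_partition x y s ->
  increasing_itvs x y (steps x s).
Proof.
move=> xys; apply/andP; split.
  by apply/allP => z; exact: steps_in.
elim: s x xys => [//|w s IH] x [/= /andP[xw ws] sy].
have {IH}/= -> := IH w (conj ws sy); rewrite andbT.
by apply/allP => z /(steps_in (conj ws sy)) /andP[].
Qed.

Lemma sum_steps x y s f : itv_partition x y s ->
  \sum_(z <- steps x s) (f z.2 - f z.1) = f y - f x.
Proof.
elim: s x => [|w s IH] x [/=].
  by move=> _ /eqP ->; rewrite big_nil subrr.
by move=> /andP[xw ws] sy; rewrite steps_cons big_cons (IH w)//= addrC subrKA.
Qed.

Lemma variation_steps x y s f :
  variation x y f s = \sum_(z <- steps x s) `|f z.2 - f z.1|.
Proof.
rewrite /variation; elim: s x => [|w s IH] x.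
  by rewrite [RHS]big_nil big_geq.
by rewrite steps_cons [RHS]big_cons -IH /= big_nat_recl.
Qed.

Lemma increasing_itvs_refine a b l1 z l2 s :
  increasing_itvs a b (l1 ++ z :: l2) -> itv_partition z.1 z.2 s ->
  increasing_itvs a b ((l1 ++ steps z.1 s) ++ l2).
Proof.
rewrite /increasing_itvs -catA !all_cat !pairwise_cat /= => /andP[/and3P[al1 /and3P[az zz zb] al2]].
rewrite allrel_consr => /and3P[/andP[l1z l12] pl1 /andP[zl2 pl2]] zs.
have /andP[/allP als pls] := increasing_itvs_steps zs.
rewrite al1 al2 pl1 pls pl2 !andbT /= allrel_catr l12 andbT; apply/and3P; split.
- apply/allP => w /als/and3P[w1 -> w2].
  by rewrite (le_trans az w1) (le_trans w2 zb).
- apply/allrelP => v w vl1 /als/and3P[w1 _ _].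
  by rewrite (le_trans _ w1)//; exact: (allP l1z).
- apply/allrelP => v w /als/and3P[_ _ v2] wl2.
  by rewrite (le_trans v2)//; exact: (allP zl2).
Qed.

(* The intervals of l1 are already refined, those of l2 are still to be. *)
Lemma sum_total_variation_le a b f d (e : R) l1 l2 :
  (forall l, increasing_itvs a b l -> \sum_(z <- l) (z.2 - z.1) < d ->
    \sum_(z <- l) `|f z.2 - f z.1| <= e) ->
  increasing_itvs a b (l1 ++ l2) -> \sum_(z <- l1 ++ l2) (z.2 - z.1) < d ->
  (forall x y, a <= x -> x <= y -> y <= b -> total_variation x y f \is a fin_num) ->
  (\sum_(z <- l1) `|f z.2 - f z.1|%:E +
    \sum_(z <- l2) total_variation z.1 z.2 f <= e%:E)%E.
Proof.
move=> H; elim: l2 l1 => [|z l2 IH] l1 ab ld bv.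
  by rewrite big_nil adde0 sumEFin lee_fin H//; move: ab ld; rewrite cats0.
have finl2 : (\sum_(w <- l2) total_variation w.1 w.2 f)%E \is a fin_num.
  apply/sum_fin_numP => w wl2 _; have /andP[/allP/(_ w)] := ab.
  rewrite mem_cat inE wl2 !orbT => /(_ isT)/and3P[? ? ?] _.
  exact: bv.
have fin1 : (\sum_(w <- l1) `|f w.2 - f w.1|%:E)%E \is a fin_num.
  by rewrite sumEFin.
rewrite big_cons addeCA -leeBrDr ?fin_numD ?finl2 ?fin1//.
(* The steps of a partition [s] of [z] join [l1], which changes neither the total length nor the
   bound. As the bound [e] is not strict, the supremum over all [s] still satisfies it. *)
apply: ge_ereal_sup => _ [_ [s zs <-] <-].
rewrite leeBrDr ?fin_numD ?finl2 ?fin1//.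
rewrite variation_steps addeA [(_%:E + _)%E]addeC -sumEFin -big_cat.
apply: IH => //; first exact: increasing_itvs_refine ab zs.
move: ld; rewrite !big_cat /= big_cons !(sum_steps id zs).
by rewrite addrA.
Qed.

Lemma sum_total_variation_le0 a b f d (e : R) l :
  (forall l, increasing_itvs a b l -> \sum_(z <- l) (z.2 - z.1) < d ->
    \sum_(z <- l) `|f z.2 - f z.1| <= e) ->
  increasing_itvs a b l -> \sum_(z <- l) (z.2 - z.1) < d ->
  (forall x y, a <= x -> x <= y -> y <= b -> total_variation x y f \is a fin_num) ->
  \sum_(z <- l) fine (total_variation z.1 z.2 f) <= e.
Proof.
move=> H lab ld bv; have := @sum_total_variation_le a b f d e [::] l H lab ld bv.
rewrite big_nil add0e -lee_fin; apply: le_trans.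
rewrite -sumEFin big_seq [leRHS]big_seq; apply: lee_sum => z zl.
have /andP[/allP/(_ z zl)/and3P[? ? ?] _] := lab.
by rewrite fineK// bv.
Qed.

(** With [d] the modulus for [e = 1], an interval shorter than [d] has variation at most 1. A longer
    one is exhausted from [a] in finitely many steps of length [d / 2], strictly below [d]. *)
Lemma ac_total_variation_lty a b f : a <= b -> ac a b f ->
  forall x y, a <= x -> x <= y -> y <= b -> total_variation x y f \is a fin_num.
Proof.
move=> ab /(_ _ ltr01)[d d0 H].
have small x y : a <= x -> x <= y -> y <= b -> y - x < d ->
    total_variation x y f \is a fin_num.
  move=> ax xy yb xyd; rewrite ge0_fin_numE ?total_variation_ge0//.
  rewrite (@le_lt_trans _ _ 1%:E) ?ltry//; apply: ge_ereal_sup => _ [_ [s xys <-] <-].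
  rewrite variation_steps lee_fin H//; last by rewrite (sum_steps id xys).
  have /andP[/allP h1 h2] := increasing_itvs_steps xys.
  apply/andP; split => //; apply/allP => z /h1/and3P[z1 -> z2].
  by rewrite (le_trans ax z1) (le_trans z2 yb).
suff from_a (n : nat) y : a <= y -> y <= b -> y - a < n%:R * (d / 2) ->
    total_variation a y f \is a fin_num.
  move=> x y ax xy yb.
  have : total_variation a y f \is a fin_num.
    have d2 : 0 < d / 2 by lra.
    have := archi_boundP (divr_ge0 (_ : 0 <= y - a) (ltW d2)).
    rewrite subr_ge0 (le_trans ax xy) => /(_ isT).
    by rewrite ltr_pdivrMr//; apply: from_a => //; rewrite (le_trans ax xy).
  by rewrite (total_variationD f ax xy) fin_numD => /andP[].
elim: n y => [|n IH] y ay yb.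
  by rewrite mul0r; lra.
rewrite -natr1 mulrDl mul1r => yn.
have [yd|dy] := ltP (y - a) d; first exact: small.
rewrite (@total_variationD _ a y (y - d / 2))//; try lra.
rewrite fin_numD IH ?small//; lra.
Qed.

(** An increment of the variation function is the total variation of [f] on that interval, so a
    modulus of [f] also serves here. *)
Lemma ac_total_variation a b f : a <= b -> ac a b f ->
  ac a b (fun x => fine (total_variation a x f)).
Proof.
move=> ab acf e e0; have [d d0 H] := acf e e0; exists d => // l lab ld.
have bv := ac_total_variation_lty ab acf.
apply: le_trans (sum_total_variation_le0 H lab ld bv).
rewrite big_seq [leRHS]big_seq; apply: ler_sum => z zl.
have /andP[/allP/(_ z zl)/and3P[az zz zb] _] := lab.
rewrite (total_variationD f az zz) fineD ?bv ?(le_trans az zz) ?(le_trans zz zb)//.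
by rewrite addrAC subrr add0r ger0_norm// fine_ge0// total_variation_ge0.
Qed.

Lemma acB a b f g : ac a b f -> ac a b g -> ac a b (f \- g).
Proof.
move=> acf acg e e0.
have e2 : 0 < e / 2 by lra.
have [d1 d10 Hf] := acf _ e2; have [d2 d20 Hg] := acg _ e2.
exists (Num.min d1 d2); first by rewrite lt_min d10.
move=> l lab; rewrite lt_min => /andP[l1 l2].
rewrite [e]splitr (le_trans _ (lerD (Hf l lab l1) (Hg l lab l2)))//.
rewrite -big_split; apply: ler_sum => z _ /=.
rewrite (_ : f z.2 - g z.2 - (f z.1 - g z.1) = (f z.2 - f z.1) - (g z.2 - g z.1)); last by ring.
exact: ler_normB.
Qed.

(** * Stieltjes measures of absolutely continuous functions *)

Lemma lebesgue_stieltjes_itvoc (F : cumulative R R) x y : x <= y ->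
  lebesgue_stieltjes_measure F `]x, y]%classic = (F y - F x)%:E.
Proof.
move=> xy; rewrite /lebesgue_stieltjes_measure /measure_extension.
by rewrite measurable_mu_extE/=; [rewrite wlength_itv_bnd|exact: is_ocitv].
Qed.

Section uniform_grid.
Variables (a b : R).
Hypothesis ab : a < b.

Definition grid n k : R := a + k%:R * ((b - a) / n.+1%:R).

Lemma grid_step_gt0 n : 0 < (b - a) / n.+1%:R.
Proof. by rewrite divr_gt0// subr_gt0. Qed.

Lemma grid_le n j k : (j <= k)%N -> grid n j <= grid n k.
Proof.
by move=> jk; rewrite lerD2l ler_wpM2r ?ler_nat// ltW// grid_step_gt0.
Qed.

Lemma grid_lt n k : grid n k < grid n k.+1.
Proof. by rewrite ltrD2l ltr_pM2r ?ltr_nat ?grid_step_gt0. Qed.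

Lemma grid0 n : grid n 0 = a. Proof. by rewrite /grid mul0r addr0. Qed.

Lemma grid_max n : grid n n.+1 = b.
Proof. by rewrite /grid mulrC divfK ?pnatr_eq0// addrC subrK. Qed.

Lemma grid_cell n x : a < x -> x <= b ->
  exists2 k, (k < n.+1)%N & x \in `](grid n k), (grid n k.+1)].
Proof.
move=> ax xb; pose P k := x <= grid n k.
have exP : exists k, P k by exists n.+1; rewrite /P grid_max.
case: (ex_minnP exP) => -[|k].
  by rewrite /P grid0 leNgt ax.
rewrite /P => xk kmin; exists k.
  by have := kmin n.+1; rewrite grid_max; apply.
by rewrite in_itv/= xk andbT ltNge; apply/negP => /kmin; rewrite ltnn.
Qed.

Lemma lebesgue_measure_grid n k :
  mu `](grid n k), (grid n k.+1)]%classic = (grid n k.+1 - grid n k)%:E.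
Proof. by rewrite lebesgue_measure_itv/= lte_fin grid_lt. Qed.

Lemma increasing_itvs_grid n (P : pred nat) :
  increasing_itvs a b [seq (grid n k, grid n k.+1) | k <- index_iota 0 n.+1 & P k].
Proof.
apply/andP; split.
  apply/allP => _ /mapP[k + ->] /=; rewrite mem_filter mem_index_iota => /andP[_ kn].
  have := grid_le n (leq0n k); rewrite grid0 => ->.
  by have := @grid_le n k.+1 n.+1 kn; rewrite grid_max => ->; rewrite grid_le.
rewrite pairwise_map pairwise_filter//.
have : pairwise ltn (index_iota 0 n.+1).
  by rewrite -sorted_pairwise ?iota_ltn_sorted//; exact: ltn_trans.
by apply: sub_pairwise => j k jk /=; rewrite grid_le.
Qed.

Lemma grid_cell_ball n x r : a < x -> x <= b -> (b - a) / n.+1%:R < r ->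
  exists2 k, (k < n.+1)%N &
    x \in `](grid n k), (grid n k.+1)] /\
    `](grid n k), (grid n k.+1)]%classic `<=` ball x r.
Proof.
move=> ax xb hr; have [k kn xk] := grid_cell n ax xb; exists k => //; split => //.
move=> y /=; rewrite in_itv/= => /andP[ky yk].
move: xk; rewrite in_itv/= => /andP[kx xk].
have kk : grid n k.+1 - grid n k = (b - a) / n.+1%:R.
  by rewrite /grid -[k.+1%:R]natr1; set h := (b - a) / _; ring.
move: hr; rewrite -kk /ball/= => hr; rewrite ltr_norml; apply/andP; split; lra.
Qed.

Lemma grid_trivIset n (P : pred 'I_n.+1) :
  trivIset P (fun k : 'I_n.+1 => `](grid n k), (grid n k.+1)]%classic).
Proof.
suff H j k t : (j < k)%N -> `](grid n j), (grid n j.+1)]%classic t ->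
    `](grid n k), (grid n k.+1)]%classic t -> False.
  move=> j k _ _ [t [jt kt]]; apply/val_inj; have [jk|jk|//] := ltngtP j k.
    by case: (H j k t).
  by case: (H k j t).
move=> jk /=; rewrite !in_itv/= => /andP[_ tj] /andP[kt _].
by have := grid_le n jk; rewrite leNgt (lt_le_trans kt tj).
Qed.

End uniform_grid.

(* N is enclosed in an open set U of small measure, and U is exhausted from
   inside by the grid cells that it contains: these are finitely many disjoint
   intervals, to which absolute continuity applies. *)
Lemma ac_lebesgue_stieltjes_null a b (F : cumulative R R) (N : set R) :
  a < b -> ac a b F -> measurable N -> mu N = 0%E ->
  lebesgue_stieltjes_measure F (N `&` `]a, b]) = 0%E.
Proof.
move=> ab acF mN N0; set la := lebesgue_stieltjes_measure F.
apply/eqP; rewrite eq_le measure_ge0 andbT; apply/lee_addgt0Pr => e e0.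
rewrite add0e; have [d d0 H] := acF e e0.
have Noo : (mu N < +oo)%E by rewrite N0 ltry.
have [U [oU NU Ud]] := lebesgue_regularity_outer mN Noo d0.
have mU : measurable U by exact: open_measurable.
have {}Ud : (mu U < d%:E)%E.
  rewrite (le_lt_trans _ Ud)// -[leRHS]adde0 -N0 -{1}(setDUK NU) setUC.
  by rewrite (le_trans (measureU2 _ _ _))//; exact: measurableD.
pose I n k := `](grid a b n k), (grid a b n k.+1)]%classic : set R.
pose P n k := `[< I n k `<=` U >].
pose W n := \big[setU/set0]_(k < n.+1 | P n k) I n k.
have WE n : W n = \bigcup_(k in [set k | (k \in index_iota 0 n.+1) && P n k]) I n k.
  by rewrite bigcup_seq_cond big_mkord.
have mW n : measurable (W n).
  by apply: bigsetU_measurable => k _; exact: measurable_itv.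
have WU n : W n `<=` U.
  by rewrite WE => x [k /= /andP[_ /asboolP PU]]; exact: PU.
have WF n : (la (W n) <= e%:E)%E.
  rewrite /la /W measure_bigsetU_ord_cond; last 2 first.
    by move=> k _; exact: measurable_itv.
    exact: grid_trivIset.
  rewrite (eq_bigr (fun k : 'I_n.+1 =>
    (F (grid a b n k.+1) - F (grid a b n k))%:E)); last first.
    by move=> k _; apply: lebesgue_stieltjes_itvoc; exact: grid_le.
  rewrite sumEFin lee_fin.
  have := H _ (increasing_itvs_grid ab n (P n)).
  rewrite !big_map !big_filter !big_mkord /=.
  move=> {}H; apply: le_trans (H _).
    by apply: ler_sum => k _; rewrite ler_norm.
  rewrite -lte_fin (le_lt_trans _ Ud)// //.
  rewrite -sumEFin; rewrite (eq_bigr (fun k : 'I_n.+1 => mu (I n k))); last first.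
    by move=> k _; rewrite lebesgue_measure_grid.
  rewrite -measure_bigsetU_ord_cond; last 2 first.
    by move=> k _; exact: measurable_itv.
    exact: grid_trivIset.
  by apply: le_measure; [rewrite inE; exact: (mW n)|rewrite inE|exact: (WU n)].
(* Uniform grids of different orders are not nested, so the [W n] need not increase. Their tail
   intersections [E n] do, keep Stieltjes measure at most [e], and still exhaust the points of [N]
   in []a, b]]: a ball inside [U] around such a point contains the cell of that point in every
   sufficiently fine grid. *)
pose E n := \bigcap_(m in [set m | (n <= m)%N]) W m.
have mE n : measurable (E n) by apply: bigcap_measurable => //; exists n => /=.
have mUE : measurable (\bigcup_n E n) by apply: bigcup_measurable => n _.
have cvE : la (E n) @[n --> \oo] --> la (\bigcup_n E n).
  apply: nondecreasing_cvg_mu => //.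
  move=> n m nm; apply/subsetPset => x Ex k /= mk; apply: Ex => /=.
  exact: leq_trans nm mk.
apply: (@le_trans _ _ (la (\bigcup_n E n))).
  apply: le_measure; rewrite ?inE//; first exact: measurableI.
  move=> x [/NU Ux /=]; rewrite in_itv/= => /andP[ax xb].
  have [r /= r0 rU] : nbhs_ball x U by apply/nbhs_ballP; exact: open_nbhs_nbhs.
  have ba0 : 0 <= (b - a) / r by rewrite divr_ge0// ?subr_ge0 ltW.
  have ban := archi_boundP ba0; exists (Num.bound ((b - a) / r)) => // m /= nm.
  have mr : (b - a) / m.+1%:R < r.
    rewrite ltr_pdivrMr// mulrC -ltr_pdivrMr// (lt_le_trans ban)// ler_nat.
    exact: leq_trans nm (leqnSn _).
  have [k km [xk kU]] := grid_cell_ball ax xb mr.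
  rewrite WE; exists k => //=; rewrite mem_index_iota km/=; apply/asboolP.
  exact: subset_trans kU rU.
rewrite -(cvg_lim _ cvE)//; apply: lime_le; first by apply/cvg_ex; eexists; exact: cvE.
apply: nearW => n; rewrite (le_trans _ (WF n))//.
apply: le_measure; [by rewrite inE; exact: mE|by rewrite inE; exact: mW|].
by move=> x Ex; exact: (Ex n (leqnn n)).
Qed.

(** * Primitives of integrable functions *)

Definition primitive a b f g := mu.-integrable `[a, b] (EFin \o g) /\
  forall x, a <= x -> x <= b -> f x = f a + \int[mu]_(t in `[a, x]) g t.

Lemma ac_near a b f : ac a b f -> forall e : R, 0 < e ->
  exists2 d : R, 0 < d & forall x y, a <= x -> x <= b -> a <= y -> y <= b ->
    `|y - x| < d -> `|f y - f x| <= e.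
Proof.
move=> acf e e0; have [d d0 H] := acf e e0; exists d => //.
move=> x y; wlog xy : x y / x <= y.
  move=> h; have [/h//|/ltW/h{}h] := leP x y.
  by move=> ? ? ? ?; rewrite distrC [leLHS]distrC; exact: h.
move=> ax xb ay yb xyd.
have := H [:: (x, y)]; rewrite !big_seq1; apply => /=.
  by rewrite /increasing_itvs/= ax xy yb.
by rewrite (le_lt_trans (ler_norm _) xyd).
Qed.

(** Composition with [clamp a b] extends a function from [[a, b]] to the line by constants.
    Monotonicity and continuity survive, as a cumulative function, which lives on the whole line,
    demands. *)
Definition clamp a b x := Num.max a (Num.min b x).

Lemma clamp_itv a b x : a <= b -> a <= clamp a b x <= b.
Proof. by move=> ab; rewrite /clamp le_max lexx/= ge_max ab ge_min lexx. Qed.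

Lemma clamp_id a b x : a <= x -> x <= b -> clamp a b x = x.
Proof.
by move=> ax xb; rewrite /clamp min_r// max_r.
Qed.

Lemma clamp_dist a b x y : a <= b -> `|clamp a b y - clamp a b x| <= `|y - x|.
Proof.
move=> ab; wlog xy : x y / x <= y.
  move=> h; have [/h//|/ltW/h{}h] := leP x y.
  by rewrite distrC [leRHS]distrC.
rewrite [leRHS]ger0_norm ?subr_ge0// ler_norml /clamp.
rewrite /Num.max /Num.min; case: (ltP b x) => ?; case: (ltP b y) => ?;
  do ![case: ltP => ?]; apply/andP; split; lra.
Qed.

Lemma clamp_le a b : {homo clamp a b : x y / x <= y}.
Proof.
move=> x y xy; rewrite /clamp /Num.max /Num.min.
by case: (ltP b x) => ?; case: (ltP b y) => ?; do ![case: ltP => ?]; lra.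
Qed.

Lemma ac_clamp_continuous a b f : a <= b -> ac a b f ->
  continuous (f \o clamp a b).
Proof.
move=> ab /ac_near acf x; apply/cvgrPdist_le => e e0.
have [d d0 H] := acf _ e0; exists d => //= y xy.
have /andP[ax xb] := clamp_itv x ab; have /andP[ay yb] := clamp_itv y ab.
by apply: H => //; rewrite (le_lt_trans _ xy)// clamp_dist.
Qed.

Lemma ac_clamp a b f : a <= b -> ac a b f -> ac a b (f \o clamp a b).
Proof.
move=> ab acf e e0; have [d d0 H] := acf e e0; exists d => // l lab ld.
apply: le_trans (H l lab ld); rewrite big_seq [leRHS]big_seq; apply: ler_sum => z zl.
have /andP[/allP/(_ z zl)/and3P[az zz zb] _] := lab.
by rewrite /= !clamp_id// ?(le_trans az zz) ?(le_trans zz zb).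
Qed.

Lemma ac_nondecreasing_primitive a b f : a < b -> ac a b f ->
  (forall x y, a <= x -> x <= y -> y <= b -> f x <= f y) ->
  exists g, primitive a b f g.
Proof.
move=> ab acf ndf; have leab := ltW ab; pose F0 : R -> R := f \o clamp a b.
have ndF : nondecreasing F0.
  move=> x y xy; have /andP[ax xb] := clamp_itv x leab.
  by have /andP[ay yb] := clamp_itv y leab; apply: ndf => //; exact: clamp_le.
have rcF : right_continuous F0.
  by apply: right_continuousW; exact: ac_clamp_continuous.
pose F : cumulative R R := HB.pack F0 (isCumulative.Build R _ R F0 ndF rcF).
pose la : {measure set (g_sigma_algebraType R.-ocitv.-measurable) -> \bar R} :=
  lebesgue_stieltjes_measure F.
have mD : measurable (`]a, b]%classic : set (g_sigma_algebraType R.-ocitv.-measurable)).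
  exact: measurable_itv.
have Foo : (la `]a, b]%classic < +oo)%E.
  by rewrite /la/= lebesgue_stieltjes_itvoc ?ltry.
pose nu : {finite_measure set (g_sigma_algebraType R.-ocitv.-measurable) -> \bar R} :=
  mfrestr mD Foo.
have nu_mu : nu `<< mu.
  move=> N; rewrite /null_set /= => N0 A mA AN.
  apply: ac_lebesgue_stieltjes_null => //; last exact: N0.
  exact: ac_clamp.
have [g [g0 gfin gint nug]] := radon_nikodym_sigma_finite nu_mu.
have gE : EFin \o (fine \o g) = g.
  by apply/funext => x /=; rewrite fineK.
exists (fine \o g); split.
  by rewrite gE; apply: integrableS gint.
move=> x ax xb.
rewrite -Rintegral_itv_obnd_cbnd; last by rewrite gE; apply: integrableS gint.
have /(congr1 fine) := nug `]a, x]%classic (measurable_itv _).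
rewrite /nu /= /mfrestr /mrestr setIidl; last first.
  by apply: subset_itvl; rewrite bnd_simp.
rewrite /la/= lebesgue_stieltjes_itvoc//= /F0/= !clamp_id//.
rewrite /Rintegral/=.
have -> : (fun t => (fine (g t))%:E) = g by [].
by move=> <-; rewrite addrC subrK.
Qed.
Lemma integrable_EFinD (D : set (measurableTypeR R)) f g : measurable D ->
  mu.-integrable D (EFin \o f) -> mu.-integrable D (EFin \o g) ->
  mu.-integrable D (EFin \o (f \+ g)).
Proof. by move=> mD fi gi; exact: (integrableD mD fi gi). Qed.

Lemma integrable_EFinB (D : set (measurableTypeR R)) f g : measurable D ->
  mu.-integrable D (EFin \o f) -> mu.-integrable D (EFin \o g) ->
  mu.-integrable D (EFin \o (f \- g)).
Proof. by move=> mD fi gi; exact: (integrableB mD fi gi). Qed.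

Lemma integrable_EFinZl (D : set (measurableTypeR R)) (c : R) f : measurable D ->
  mu.-integrable D (EFin \o f) -> mu.-integrable D (EFin \o (fun x => c * f x)).
Proof. by move=> mD fi; exact: (integrableZl mD c fi). Qed.

Lemma integrable_itvcc a b f x : mu.-integrable `[a, b] (EFin \o f) -> x <= b ->
  mu.-integrable `[a, x] (EFin \o f).
Proof.
move=> fi xb; apply: integrableS fi => //.
by apply: subset_itvl; rewrite bnd_simp.
Qed.

Lemma primitiveB a b f1 f2 g1 g2 : primitive a b f1 g1 -> primitive a b f2 g2 ->
  primitive a b (f1 \- f2) (g1 \- g2).
Proof.
move=> [i1 h1] [i2 h2]; split; first exact: integrable_EFinB.
move=> x ax xb; rewrite RintegralB//; [|exact: integrable_itvcc xb..].
by rewrite /= h1// h2//; ring.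
Qed.

Lemma primitiveD a b f1 f2 g1 g2 : primitive a b f1 g1 -> primitive a b f2 g2 ->
  primitive a b (f1 \+ f2) (g1 \+ g2).
Proof.
move=> [i1 h1] [i2 h2]; split; first exact: integrable_EFinD.
move=> x ax xb; rewrite RintegralD//; [|exact: integrable_itvcc xb..].
by rewrite /= h1// h2//; ring.
Qed.

Lemma eq_primitive a b f1 f2 g : (forall x, a <= x -> x <= b -> f1 x = f2 x) ->
  a <= b -> primitive a b f1 g -> primitive a b f2 g.
Proof.
by move=> f12 ab [gi h]; split => // x ax xb; rewrite -!f12// h.
Qed.

(** Jordan decomposition: the variation [V] and [V - f] are both absolutely continuous and
    nondecreasing, because [V] grows at least as much as [f] varies. The density of [f] is the
    difference of theirs. *)
Lemma ac_primitive a b f : a < b -> ac a b f -> exists g, primitive a b f g.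
Proof.
move=> ab acf; have leab := ltW ab.
pose V x := fine (total_variation a x f).
have bv := ac_total_variation_lty leab acf.
have acV : ac a b V by exact: ac_total_variation.
have Vxy x y : a <= x -> x <= y -> y <= b -> `|f y - f x| <= V y - V x.
  move=> ax xy yb; rewrite /V (total_variationD f ax xy) fineD ?bv// ?(le_trans xy)//.
  rewrite addrAC subrr add0r -lee_fin fineK ?bv//.
  exact: total_variation_ge.
have [|g1 H1] := ac_nondecreasing_primitive ab acV.
  move=> x y ax xy yb; rewrite -subr_ge0 (le_trans _ (Vxy x y ax xy yb))//.
have [|g2 H2] := ac_nondecreasing_primitive ab (acB acV acf).
  move=> x y ax xy yb; have := Vxy x y ax xy yb; rewrite ler_norml => /andP[_] /=.
  by lra.
exists (g1 \- g2); apply: (eq_primitive _ leab (primitiveB H1 H2)) => x ax xb /=.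
by rewrite opprB addrC subrK.
Qed.

(** Lebesgue differentiation for [g0], the extension of [g] by 0 outside [[a, b]]. Near an interior
    point [f] is [f a] plus the integral of [g0], so the derivative transfers to [f]. *)
Lemma primitive_derive a b f g : a < b -> primitive a b f g ->
  {ae mu, forall x, x \in `]a, b[ -> is_derive x 1 f (g x)}.
Proof.
move=> ab [gi fg]; pose g0 := g \_ `[a, b].
have gi0 : mu.-integrable setT (EFin \o g0).
  by rewrite -restrict_EFin; apply/integrable_restrict => //=; rewrite setTI.
have := @FTC1 R g0 (BLeft a) _ (integrable_locally (measurable_itv _) gi).
have gi1 y : mu.-integrable `[a, y] (EFin \o g0) by apply: integrableS gi0.
move=> /(_ gi1); set F := fun x => _; apply: filterS.
  exact: (ae_filter_ringOfSetsType mu).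
move=> x /= H; rewrite in_itv/= => /andP[ax xb].
move: H; rewrite lte_fin => /(_ ax)[dF DF].
have dF1 : is_derive x 1 F (g x).
  apply: DeriveDef => //; rewrite -derive1E DF /g0 patchE mem_set//=.
  by rewrite in_itv/= !ltW.
apply: (@near_eq_is_derive _ _ _ (fun y => f a + F y)).
  have : x \in `]a, b[ by rewrite in_itv/= ax xb.
  move=> /near_in_itvoo; apply: filterS => y; rewrite in_itv/= => /andP[ay yb].
  rewrite [in RHS]fg ?ltW// /F; congr (_ + _); apply: eq_Rintegral => t.
  rewrite inE/= in_itv/= => /andP[at1 ty]; rewrite /g0 patchE mem_set//=.
  by rewrite in_itv/= at1 (le_trans ty)// ltW.
rewrite -[X in is_derive _ _ _ X]add0r.
exact: is_deriveD.
Qed.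
Lemma primitive_increment a b f g u v : primitive a b f g -> a <= u -> u <= v ->
  v <= b -> f v - f u = \int[mu]_(t in `]u, v]) g t.
Proof.
move=> [gi fg] au uv vb; rewrite fg ?(le_trans au)// [f u]fg ?(le_trans uv)//.
rewrite opprD addrACA subrr add0r Rintegral_itvB//.
- exact: integrable_itvcc vb.
Qed.

Lemma primitive_increment_le a b f g u v : primitive a b f g -> a <= u -> u <= v ->
  v <= b -> `|f v - f u| <= \int[mu]_(t in `]u, v]) `|g t|.
Proof.
move=> fg au uv vb; rewrite (primitive_increment fg)//.
apply: le_normr_Rintegral => //; apply: integrableS fg.1 => //.
exact: subset_itvScc.
Qed.

(** Absolute continuity of the integral, applied to the union [U] of the intervals. Increments are
    integrals over []u, v]], but only the open intervals are disjoint; the right endpoints are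
    null. *)
Lemma primitive_uniformly_small a b f g : primitive a b f g ->
  forall e : R, 0 < e -> exists2 d : R, 0 < d &
    forall (n : nat) (u v : 'I_n -> R),
      (forall i, a <= u i /\ u i <= v i /\ v i <= b) ->
      trivIset setT (fun i => `]u i, v i[%classic) ->
      \sum_(i < n) (v i - u i) < d ->
      \sum_(i < n) `|f (v i) - f (u i)| < e.
Proof.
move=> fg e e0; pose g0 := g \_ `[a, b].
have gi0 : mu.-integrable setT (EFin \o g0).
  by rewrite -restrict_EFin; apply/integrable_restrict; rewrite //= setTI fg.1.
have [d [d0 H]] := integral_normr_continuous gi0 e0.
exists d => // n u v uv tI uvd.
pose U := \big[setU/set0]_(i < n) `]u i, v i[%classic : set (measurableTypeR R).
have mU : measurable U by apply: bigsetU_measurable => i _; exact: measurable_itv.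
have muU : (mu U < d%:E)%E.
  rewrite /U measure_bigsetU_ord//.
  rewrite (eq_bigr (fun i => (v i - u i)%:E)); first by rewrite sumEFin lte_fin.
  move=> i _; have [_ [ui _]] := uv i; rewrite /= lebesgue_measure_itv/= lte_fin.
  by case: ltP => // vu; rewrite (@le_anti _ _ (v i) (u i)) ?vu ?ui// subrr.
apply: le_lt_trans (H _ mU muU).
have gS (i : 'I_n) : `]u i, v i]%classic `<=` `[a, b].
  by have [? [? ?]] := uv i; exact: subset_itvScc.
rewrite -lee_fin /Rintegral fineK; last first.
  apply: integrable_fin_num => //; apply: integrableS (integrable_norm gi0) => //.
rewrite ge0_integral_bigsetU//.
- rewrite -sumEFin; apply: lee_sum => i _; have [ai [ui vi]] := uv i.
  apply: (@le_trans _ _ (\int[mu]_(t in `]u i, v i]) `|g t|)%:E).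
    by rewrite lee_fin (primitive_increment_le fg).
  rewrite /Rintegral fineK; last first.
    apply: integrable_fin_num => //; apply: integrable_norm.
    by apply: integrableS fg.1 => //; exact: gS.
  rewrite integral_itv_bndo_bndc; last first.
    by have /integrableP[+ _] := integrable_norm gi0; exact: measurable_funS.
  rewrite le_eqVlt; apply/orP; left; apply/eqP; apply: eq_integral => t.
  rewrite inE => /gS tab; rewrite /g0 patchE mem_set//.
- exact: index_enum_uniq.
- by apply: sub_trivIset tI.
- by have /integrableP[+ _] := integrable_norm gi0; exact: measurable_funS.
Qed.

Lemma primitive_ac a b f g : primitive a b f g -> ac a b f.
Proof. by move=> fg; apply: acP; exact: primitive_uniformly_small fg. Qed.

Lemma eq_primitive_deriv a b f g h : (forall x, a <= x -> x <= b -> g x = h x) ->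
  primitive a b f g -> primitive a b f h.
Proof.
move=> gh [gi fg]; split.
  by apply: eq_integrable gi => // x; rewrite inE/= in_itv/= => /andP[? ?] /=; rewrite gh.
move=> x ax xb; rewrite fg//; congr (_ + _); apply: eq_Rintegral => t.
by rewrite inE/= in_itv/= => /andP[at1 tx]; rewrite gh// (le_trans tx).
Qed.

Lemma ae_mono (P Q : R -> Prop) : (forall x, P x -> Q x) ->
  {ae mu, forall x, P x} -> {ae mu, forall x, Q x}.
Proof. by move=> PQ; apply: filterS => //; exact: (ae_filter_ringOfSetsType mu). Qed.

Lemma ae_mono2 (P P' Q : R -> Prop) : (forall x, P x -> P' x -> Q x) ->
  {ae mu, forall x, P x} -> {ae mu, forall x, P' x} -> {ae mu, forall x, Q x}.
Proof.
by move=> PQ; apply: filterS2 => //; exact: (ae_filter_ringOfSetsType mu).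
Qed.

Lemma ae_mono3 (P1 P2 P3 Q : R -> Prop) : (forall x, P1 x -> P2 x -> P3 x -> Q x) ->
  {ae mu, forall x, P1 x} -> {ae mu, forall x, P2 x} -> {ae mu, forall x, P3 x} ->
  {ae mu, forall x, Q x}.
Proof.
by move=> PQ; apply: filterS3 => //; exact: (ae_filter_ringOfSetsType mu).
Qed.

Lemma eq_Rintegral_ae a b f g x : 
  {ae mu, forall x, x \in `]a, b[ -> f x = g x} ->
  mu.-integrable `[a, b] (EFin \o f) -> mu.-integrable `[a, b] (EFin \o g) ->
  x <= b -> \int[mu]_(t in `[a, x]) f t = \int[mu]_(t in `[a, x]) g t.
Proof.
move=> fg fi gi xb; rewrite /Rintegral; congr fine.
have sub : `]a, x[%classic `<=` `[a, b].
  by apply: subset_itv; rewrite bnd_simp.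
have mf : measurable_fun `]a, x[ (EFin \o f).
  by have /integrableP[+ _] := fi; exact: measurable_funS.
have mg : measurable_fun `]a, x[ (EFin \o g).
  by have /integrableP[+ _] := gi; exact: measurable_funS.
rewrite integral_itv_bndoo//; rewrite [RHS]integral_itv_bndoo//.
apply: ae_eq_integral => //; apply: ae_mono fg => t /= fgt tax.
by congr EFin; apply: fgt; apply: subset_itvl tax; rewrite bnd_simp.
Qed.

(** Absolute continuity provides some density, and two a.e. derivatives of [f] agree a.e. Product
    rule, exponential rule and the passage from the differential expression to a system all rest on
    this: absolute continuity and the pointwise derivative are checked separately. *)
Lemma ac_is_derive_primitive a b f h : a < b -> ac a b f ->
  mu.-integrable `[a, b] (EFin \o h) ->
  {ae mu, forall x, x \in `]a, b[ -> is_derive x 1 f (h x)} -> primitive a b f h.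
Proof.
move=> ab acf hi fh; have [g fg] := ac_primitive ab acf; split => // x ax xb.
rewrite fg.2//; congr (_ + _); apply: eq_Rintegral_ae (xb) => //; last exact: fg.1.
apply: ae_mono2 _ fh (primitive_derive ab fg) => t ft gt tab.
have [_ <-] := ft tab; by have [_ <-] := gt tab.
Qed.

Lemma primitive_continuous a b f g : a <= b -> primitive a b f g ->
  continuous (f \o clamp a b).
Proof. by move=> ab /primitive_ac; exact: ac_clamp_continuous. Qed.

Lemma primitive_measurable a b f g : a <= b -> primitive a b f g ->
  measurable_fun `[a, b] f.
Proof.
move=> ab fg; apply: (@eq_measurable_fun _ _ _ _ _ (f \o clamp a b)).
  by move=> x; rewrite inE/= in_itv/= => /andP[? ?]; rewrite clamp_id.
apply: measurable_funTS; apply: continuous_measurable_fun.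
exact: primitive_continuous fg.
Qed.

Lemma primitive_bounded a b f g : primitive a b f g ->
  exists2 M : R, 0 <= M & forall x, a <= x -> x <= b -> `|f x| <= M.
Proof.
move=> fg; exists (`|f a| + \int[mu]_(t in `[a, b]) `|g t|).
  by rewrite addr_ge0// Rintegral_ge0.
move=> x ax xb; rewrite fg.2// (le_trans (ler_normD _ _))// lerD2l.
have gix := integrable_itvcc fg.1 xb.
rewrite (le_trans (le_normr_Rintegral _ gix))//.
rewrite /Rintegral fine_le//.
- by apply: integrable_fin_num => //; exact: integrable_norm.
- by apply: integrable_fin_num => //; apply: integrable_norm; exact: fg.1.
- apply: ge0_subset_integral => //=.
  + by have /integrableP[] := integrable_norm fg.1.
  + by apply: subset_itvl; rewrite bnd_simp.
Qed.

Lemma integrable_bounded_mul a b f g (M : R) : measurable_fun `[a, b] f ->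
  (forall x, a <= x -> x <= b -> `|f x| <= M) ->
  mu.-integrable `[a, b] (EFin \o g) -> mu.-integrable `[a, b] (EFin \o (f \* g)).
Proof.
move=> mf fM gi; have H := @integrableMr _ _ _ mu `[a, b]%classic (measurable_itv _) f.
have : mu.-integrable `[a, b] ((EFin \o f) \* (EFin \o g))%E.
  apply: H => //; exists M; split; first exact: num_real.
  move=> N MN x /=; rewrite in_itv/= => /andP[ax xb].
  by rewrite (le_trans (fM x ax xb))// ltW.
by apply: eq_integrable => //.
Qed.

(** Two dominating functions suit a product; for the exponential the same one is used twice. The
    sign of [C] is free, hence the positive constant [|C| + 1] in the modulus. *)
Lemma ac_dominated a b f g h (C : R) : (forall x y, a <= x -> x <= y -> y <= b ->
    `|h y - h x| <= C * (`|f y - f x| + `|g y - g x|)) ->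
  ac a b f -> ac a b g -> ac a b h.
Proof.
move=> hC acf acg e e0; pose D := `|C| + 1.
have D0 : 0 < D by rewrite ltr_wpDl.
have e2 : 0 < e / (2 * D) by rewrite divr_gt0// mulr_gt0.
have [d1 d10 Hf] := acf _ e2; have [d2 d20 Hg] := acg _ e2.
exists (Num.min d1 d2); first by rewrite lt_min d10.
move=> l lab; rewrite lt_min => /andP[l1 l2].
have -> : e = D * (e / (2 * D) + e / (2 * D)) by field; rewrite gt_eqF.
apply: le_trans (ler_wpM2l (ltW D0) (lerD (Hf l lab l1) (Hg l lab l2))).
rewrite -big_split big_distrr/= big_seq [leRHS]big_seq; apply: ler_sum => z zl.
have /andP[/allP/(_ z zl)/and3P[az zz zb] _] := lab.
rewrite (le_trans (hC _ _ az zz zb))// ler_wpM2r ?addr_ge0//.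
by rewrite (le_trans (ler_norm _))// lerDl.
Qed.

Lemma primitiveM a b f1 f2 g1 g2 : a < b -> primitive a b f1 g1 ->
  primitive a b f2 g2 ->
  primitive a b (f1 \* f2) (fun x => f1 x * g2 x + f2 x * g1 x).
Proof.
move=> ab fg1 fg2; have leab := ltW ab.
have [M1 M10 H1] := primitive_bounded fg1; have [M2 M20 H2] := primitive_bounded fg2.
apply: ac_is_derive_primitive => //.
- apply: (ac_dominated (C := M1 + M2) _ (primitive_ac fg1) (primitive_ac fg2)).
  move=> x y ax xy yb /=.
  have -> : f1 y * f2 y - f1 x * f2 x = f1 y * (f2 y - f2 x) + f2 x * (f1 y - f1 x).
    by ring.
  rewrite (le_trans (ler_normD _ _))// !normrM mulrDr addrC lerD//.
    rewrite ler_wpM2r// (le_trans (H2 x _ _))// ?(le_trans xy)// lerDr//.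
  by rewrite ler_wpM2r// (le_trans (H1 y _ _))// ?(le_trans ax)// lerDl.
- apply: integrable_EFinD => //.
  + by apply: (integrable_bounded_mul _ H1 fg2.1); exact: primitive_measurable fg1.
  + by apply: (integrable_bounded_mul _ H2 fg1.1); exact: primitive_measurable fg2.
- apply: ae_mono2 _ (primitive_derive ab fg1) (primitive_derive ab fg2).
  move=> x h1 h2 xab; have {}h1 := h1 xab; have {}h2 := h2 xab.
  exact: is_deriveM.
Qed.

(** The range of [f] is bounded, and there the exponential is Lipschitz: factor out [expR (c * f x)]
    and use that [expR t] is at least [1 + t]. The rest is the chain rule almost everywhere. *)
Lemma primitive_expR a b f g (c : R) : a < b -> primitive a b f g ->
  primitive a b (fun x => expR (c * f x)) (fun x => c * g x * expR (c * f x)).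
Proof.
move=> ab fg; have [M M0 H] := primitive_bounded fg.
have expd (x y : R) : a <= x -> x <= b -> a <= y -> y <= b -> expR (c * f x) - expR (c * f y) <=
    expR (`|c| * M) * `|c| * `|f x - f y|.
  move=> ax xb ay yb.
  have -> : expR (c * f x) - expR (c * f y) =
      expR (c * f x) * (1 - expR (c * f y - c * f x)).
    by rewrite mulrBr mulr1 -expRD [c * f x + _]addrC subrK.
  rewrite -mulrA (@le_trans _ _ (expR (c * f x) * (`|c| * `|f x - f y|)))//.
    rewrite ler_wpM2l ?expR_ge0// -normrM (le_trans _ (ler_norm _))//.
    have := expR_ge1Dx (c * f y - c * f x); lra.
  rewrite ler_wpM2r ?mulr_ge0// ler_expR (le_trans (ler_norm _))// normrM.
  by rewrite ler_wpM2l// H.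
have acE : ac a b (fun x => expR (c * f x)).
  apply: (ac_dominated (C := expR (`|c| * M) * `|c|) _ (primitive_ac fg) (primitive_ac fg)).
  move=> x y ax xy yb; have xb := le_trans xy yb; have ay := le_trans ax xy.
  have C0 : 0 <= expR (`|c| * M) * `|c| by rewrite mulr_ge0// expR_ge0.
  rewrite (@le_trans _ _ (expR (`|c| * M) * `|c| * `|f y - f x|))//.
    rewrite ler_norml expd// andbT lerNl opprB.
    by rewrite (le_trans (expd _ _ ax xb ay yb))// distrC.
  by rewrite ler_wpM2l// lerDl.
apply: ac_is_derive_primitive => //.
- have [gE EgE] := ac_primitive ab acE; have leab := ltW ab.
  have [ME ME0 HE] := primitive_bounded EgE.
  have mE := primitive_measurable leab EgE.
  have := integrable_EFinZl c (measurable_itv _) (integrable_bounded_mul mE HE fg.1).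
  by apply: eq_integrable => // x _ /=; congr EFin; ring.
- apply: ae_mono (primitive_derive ab fg) => x fgx xab; have {}fgx := fgx xab.
  have h1 : is_derive x 1 (fun y => c * f y) (c * g x) by exact: is_deriveZ.
  have := @is_derive1_comp _ expR (fun y => c * f y) _ _ _ (is_derive_expR (c * f x)) h1.
  by rewrite mulrC.
Qed.

End AbsolutelyContinuousFunctions.
(** * Linear systems with integrable coefficients *)

Section LinearSystems.
Context {R : realType}.
Local Notation mu := (@lebesgue_measure R).
Variables (a b : R).
Hypothesis ab : a < b.
Let leab : a <= b := ltW ab.
Implicit Types (f g : R -> R) (x : R).

Definition L1 g := mu.-integrable `[a, b] (EFin \o g).

Definition bounded_measurable f := measurable_fun `[a, b] f /\
  exists2 M : R, 0 <= M & forall x, a <= x -> x <= b -> `|f x| <= M.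

Lemma L1D f g : L1 f -> L1 g -> L1 (fun x => f x + g x).
Proof. by move=> fi gi; exact: integrable_EFinD. Qed.

Lemma L1B f g : L1 f -> L1 g -> L1 (fun x => f x - g x).
Proof. by move=> fi gi; exact: integrable_EFinB. Qed.

Lemma L1Z (c : R) f : L1 f -> L1 (fun x => c * f x).
Proof. by move=> fi; exact: integrable_EFinZl. Qed.

Lemma L10 : L1 (fun=> 0).
Proof. exact: integrable0. Qed.

Lemma L1_norm f : L1 f -> L1 (fun x => `|f x|).
Proof. by move=> fi; exact: integrable_norm. Qed.

Lemma L1_sum (I : Type) (s : seq I) (f : I -> R -> R) : (forall i, L1 (f i)) ->
  L1 (fun x => \sum_(i <- s) f i x).
Proof.
move=> fi; elim: s => [|i s IH].
  by under eq_fun do rewrite big_nil; exact: L10.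
by under eq_fun do rewrite big_cons; exact: L1D.
Qed.

Lemma eq_L1 f g : (forall x, a <= x -> x <= b -> f x = g x) -> L1 f -> L1 g.
Proof.
move=> fg; apply: eq_integrable => // x; rewrite inE/= in_itv/= => /andP[ax xb].
by rewrite /= fg.
Qed.

Lemma L1_mul f g : bounded_measurable f -> L1 g -> L1 (fun x => g x * f x).
Proof.
move=> [mf [M M0 fM]] gi; have := integrable_bounded_mul mf fM gi.
by apply: eq_L1 => x _ _; rewrite /= mulrC.
Qed.

Lemma primitive_bounded_measurable f g : primitive a b f g -> bounded_measurable f.
Proof.
by move=> fg; split; [exact: primitive_measurable fg|exact: primitive_bounded fg].
Qed.

Lemma bounded_measurableB f g : bounded_measurable f -> bounded_measurable g ->
  bounded_measurable (fun x => f x - g x).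
Proof.
move=> [mf [M M0 fM]] [mg [N N0 gN]]; split; first exact: measurable_funB.
exists (M + N); first exact: addr_ge0.
by move=> x ax xb; rewrite (le_trans (ler_normB _ _))// lerD ?fM ?gN.
Qed.

Lemma bounded_measurableD f g : bounded_measurable f -> bounded_measurable g ->
  bounded_measurable (fun x => f x + g x).
Proof.
move=> [mf [M M0 fM]] [mg [N N0 gN]]; split; first exact: measurable_funD.
exists (M + N); first exact: addr_ge0.
by move=> x ax xb; rewrite (le_trans (ler_normD _ _))// lerD ?fM ?gN.
Qed.

Lemma bounded_measurable_norm f : bounded_measurable f ->
  bounded_measurable (fun x => `|f x|).
Proof.
move=> [mf [M M0 fM]]; split; first exact: measurableT_comp.
by exists M => // x ax xb; rewrite normr_id fM.
Qed.

Lemma bounded_measurable_cst (c : R) : bounded_measurable (fun=> c).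
Proof. by split; [exact: measurable_cst|exists `|c|]. Qed.

Lemma bounded_measurable_sum (I : Type) (s : seq I) (f : I -> R -> R) :
  (forall i, bounded_measurable (f i)) ->
  bounded_measurable (fun x => \sum_(i <- s) f i x).
Proof.
move=> fi; elim: s => [|i s IH].
  by under eq_fun do rewrite big_nil; exact: bounded_measurable_cst.
by under eq_fun do rewrite big_cons; exact: bounded_measurableD.
Qed.

Definition integral_to g x : R := \int[mu]_(t in `[a, x]) g t.

Lemma L1S g x : L1 g -> x <= b -> mu.-integrable `[a, x] (EFin \o g).
Proof. by move=> gi xb; exact: integrable_itvcc xb. Qed.

Lemma integral_toD f g x : L1 f -> L1 g -> x <= b ->
  integral_to (fun t => f t + g t) x = integral_to f x + integral_to g x.
Proof. by move=> fi gi xb; rewrite /integral_to RintegralD//; exact: L1S. Qed.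

Lemma integral_toB f g x : L1 f -> L1 g -> x <= b ->
  integral_to (fun t => f t - g t) x = integral_to f x - integral_to g x.
Proof. by move=> fi gi xb; rewrite /integral_to RintegralB//; exact: L1S. Qed.

Lemma integral_toZ (c : R) f x : L1 f -> x <= b ->
  integral_to (fun t => c * f t) x = c * integral_to f x.
Proof. by move=> fi xb; rewrite /integral_to RintegralZl//; exact: L1S. Qed.

Lemma eq_integral_to f g x : x <= b ->
  (forall t, a <= t -> t <= b -> f t = g t) -> integral_to f x = integral_to g x.
Proof.
move=> xb fg; apply: eq_Rintegral => t; rewrite inE/= in_itv/= => /andP[at1 tx].
by rewrite fg// (le_trans tx).
Qed.

Lemma integral_to_sum (I : Type) (s : seq I) (f : I -> R -> R) x :
  (forall i, L1 (f i)) -> x <= b ->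
  integral_to (fun t => \sum_(i <- s) f i t) x = \sum_(i <- s) integral_to (f i) x.
Proof.
move=> fi xb; elim: s => [|i s IH].
  rewrite big_nil (@eq_integral_to _ (fun=> 0))//; last by move=> *; rewrite big_nil.
  by rewrite /integral_to /Rintegral integral0.
rewrite big_cons -IH -integral_toD//; last exact: L1_sum.
by apply: eq_integral_to => // t _ _; rewrite big_cons.
Qed.

Lemma le_integral_to f g x : L1 f -> L1 g -> x <= b ->
  (forall t, a <= t -> t <= b -> f t <= g t) -> integral_to f x <= integral_to g x.
Proof.
move=> fi gi xb fg; apply: le_Rintegral => //; [exact: L1S..|].
by move=> t /=; rewrite in_itv/= => /andP[at1 tx]; rewrite fg// (le_trans tx).
Qed.

Lemma norm_integral_to f x : L1 f -> x <= b ->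
  `|integral_to f x| <= integral_to (fun t => `|f t|) x.
Proof. by move=> fi xb; apply: le_normr_Rintegral => //; exact: L1S. Qed.

Lemma integral_to_ge0 f x : (forall t, 0 <= f t) -> 0 <= integral_to f x.
Proof. by move=> f0; exact: Rintegral_ge0. Qed.

Lemma integral_to_mono f x y : L1 f -> (forall t, 0 <= f t) -> x <= y -> y <= b ->
  integral_to f x <= integral_to f y.
Proof.
move=> fi f0 xy yb; have xb := le_trans xy yb; rewrite /integral_to /Rintegral fine_le//.
- by apply: integrable_fin_num => //; exact: L1S.
- by apply: integrable_fin_num => //; exact: L1S.
- apply: ge0_subset_integral => //=.
  + by have /integrableP[] := L1S fi yb.
  + by move=> t _; rewrite lee_fin.
  + by apply: subset_itvl; rewrite bnd_simp.
Qed.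

Lemma primitive_integral_to (c : R) g : L1 g ->
  primitive a b (fun x => c + integral_to g x) g.
Proof.
move=> gi; split => // x ax xb; rewrite -addrA; congr (_ + _).
by rewrite {2}/integral_to set_itv1 Rintegral_set1 add0r.
Qed.

Lemma integral_to_start g : integral_to g a = 0.
Proof. by rewrite /integral_to set_itv1 Rintegral_set1. Qed.

(** Taking for [B] the supremum [S] of [v] gives [S <= A + S / 2]. The a priori boundedness of [v]
    makes [S] finite, so that half of it may be subtracted. *)
Lemma absorb (v : R -> R) (A : R) : (forall x, 0 <= v x) ->
  (exists B : R, forall x, a <= x -> x <= b -> v x <= B) ->
  (forall B : R, 0 <= B -> (forall x, a <= x -> x <= b -> v x <= B) ->
    forall x, a <= x -> x <= b -> v x <= A + B / 2) ->
  forall x, a <= x -> x <= b -> v x <= 2 * A.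
Proof.
move=> v0 [M vM] H; pose S := [set v x | x in `[a, b]].
have supS : has_sup S.
  split; first by exists (v a), a => //=; rewrite in_itv/= lexx.
  by exists M; move=> _ [x + <-]; rewrite /= in_itv/= => /andP[ax xb]; exact: vM.
have vS x : a <= x -> x <= b -> v x <= sup S.
  by move=> ax xb; apply: sup_upper_bound => //; exists x => //=; rewrite in_itv/= ax.
have S0 : 0 <= sup S := le_trans (v0 a) (vS a (lexx _) leab).
have : sup S <= A + sup S / 2.
  apply: sup_le_ub; first exact: supS.1.
  by move=> _ [x + <-]; rewrite /= in_itv/= => /andP[ax xb]; exact: H.
by move=> SA x ax xb; rewrite (le_trans (vS x ax xb))//; lra.
Qed.

(** * Exponentially weighted estimates *)

Section weight.
Variable k : R -> R.
Hypotheses (ki : L1 k) (k0 : forall t, 0 <= k t).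

(* For the norm sup |v / weight|, integration against k is a contraction of
   ratio 1/2. *)
Definition weight x : R := expR (2 * integral_to k x).

Lemma weight_ge1 x : 1 <= weight x.
Proof. by rewrite -expR0 ler_expR mulr_ge0// integral_to_ge0. Qed.

Lemma weight_gt0 x : 0 < weight x. Proof. exact: expR_gt0. Qed.

Lemma weight_le x : x <= b -> weight x <= weight b.
Proof. by move=> xb; rewrite ler_expR ler_wpM2l// integral_to_mono. Qed.

(** The derivative of [weight] is [2 * k * weight], so [k * weight] integrates to
    [(weight x - 1) / 2]. The 2 in the exponent is thus the source of the ratio 1/2. *)
Lemma weight_step (v : R -> R) (B : R) x : bounded_measurable v -> 0 <= B ->
  (forall t, a <= t -> t <= b -> v t <= B * weight t) -> a <= x -> x <= b ->
  integral_to (fun t => k t * v t) x <= B / 2 * weight x.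
Proof.
move=> vb B0 vB ax xb.
have Wp : primitive a b weight (fun x => 2 * k x * weight x).
  have := primitive_expR 2 ab (primitive_integral_to 0 ki).
  by rewrite /weight; under [X in primitive a b X]eq_fun do rewrite add0r;
    under [X in primitive a b _ X]eq_fun do rewrite add0r.
have WkL : L1 (fun t => k t * weight t).
  by apply: L1_mul => //; exact: primitive_bounded_measurable Wp.
rewrite (@le_trans _ _ (integral_to (fun t => B * (k t * weight t)) x))//.
  apply: le_integral_to => //; [exact: L1_mul|exact: L1Z|].
  by move=> t at1 tb; rewrite mulrCA ler_wpM2l ?k0// vB.
rewrite integral_toZ// -mulrA ler_wpM2l//.
have := Wp.2 x ax xb; rewrite -/(integral_to _ x).
rewrite (@eq_integral_to _ (fun t => 2 * (k t * weight t)))//; last first.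
  by move=> *; rewrite mulrA.
rewrite integral_toZ// => ->; rewrite /weight integral_to_start mulr0 expR0.
by rewrite mulrDr mulrA mulVf ?mul1r ?pnatr_eq0// lerDr.
Qed.

(** For [v / weight] the integral term costs at most half of the supremum, and [absorb] removes it.
    The constant is cruder than the classical one, but any bound linear in [c] suffices. *)
Lemma gronwall (v : R -> R) (c : R) : bounded_measurable v -> 0 <= c ->
  (forall t, 0 <= v t) ->
  (forall x, a <= x -> x <= b -> v x <= c + integral_to (fun t => k t * v t) x) ->
  forall x, a <= x -> x <= b -> v x <= 2 * c * weight x.
Proof.
move=> vb c0 v0 vc x ax xb; rewrite -ler_pdivrMr ?weight_gt0//.
move: x ax xb; apply: absorb.
- by move=> x; rewrite divr_ge0// ltW// weight_gt0.
- have [_ [M M0 vM]] := vb; exists M => x ax xb.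
  rewrite ler_pdivrMr ?weight_gt0// (le_trans (ler_norm _))// (le_trans (vM x ax xb))//.
  by rewrite ler_peMr// weight_ge1.
- move=> B B0 vB x ax xb; rewrite ler_pdivrMr ?weight_gt0// (le_trans (vc x ax xb))//.
  rewrite mulrDl lerD//; first by rewrite ler_peMr// weight_ge1.
  by apply: weight_step => // t at1 tb; rewrite -ler_pdivrMr ?weight_gt0// vB.
Qed.

End weight.

(* u - 2 C / 2 ^ m increases, u + 2 C / 2 ^ m decreases. *)
Lemma geometric_cauchy (u : nat -> R) (C : R) :
  (forall m, `|u m.+1 - u m| <= C * 2^-1 ^+ m) ->
  exists l, forall m, `|l - u m| <= 2 * C * 2^-1 ^+ m.
Proof.
move=> uC; pose h m : R := 2^-1 ^+ m.
have hS m : h m.+1 = h m / 2 by rewrite /h exprSr.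
have h0 m : 0 <= h m by rewrite /h exprn_ge0// invr_ge0.
have C0 : 0 <= C by have := uC 0; rewrite expr0 mulr1; exact: le_trans.
pose v m := u m - 2 * C * h m; pose w m := u m + 2 * C * h m.
have vS m : v m <= v m.+1 /\ w m.+1 <= w m.
  have := uC m; rewrite ler_norml -/(h m) /v /w hS => /andP[? ?].
  by split; lra.
have vnd : nondecreasing_seq v by apply/nondecreasing_seqP => m; exact: (vS m).1.
have wni : nonincreasing_seq w by apply/nonincreasing_seqP => m; exact: (vS m).2.
have vw m p : v m <= w p.
  have := vnd _ _ (leq_maxl m p); have := wni _ _ (leq_maxr m p).
  have : v (maxn m p) <= w (maxn m p) by rewrite /v /w lerD2l; have := mulr_ge0 C0 (h0 (maxn m p)); lra.
  lra.
have sv : has_sup (range v).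
  by split; [exists (v 0), 0|exists (w 0) => _ [m _ <-]].
exists (sup (range v)) => m; rewrite ler_distl; apply/andP; split.
  by apply: sup_upper_bound => //; exists m.
by apply: sup_le_ub; [exact: sv.1|move=> _ [p _ <-]; exact: vw].
Qed.

Lemma geometric_cvg (u : nat -> R) (l C : R) :
  (forall m, `|l - u m| <= C * 2^-1 ^+ m) -> u m @[m --> \oo] --> l.
Proof.
move=> uC; have h : C * 2^-1 ^+ m @[m --> \oo] --> (0 : R).
  rewrite -[0](mulr0 C); apply: cvgMr; apply: cvg_expr.
  by rewrite gtr0_norm ?invr_gt0// invf_lt1// ltr1n.
apply/cvgrPdist_le => e e0; have /cvgrPdist_le/(_ e e0) := h.
apply: filterS => m; rewrite sub0r normrN => /(le_trans _); apply.
exact: le_trans (uC m) (ler_norm _).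
Qed.

Lemma geometric_le0 (x C : R) : (forall m : nat, x <= C * 2^-1 ^+ m) -> x <= 0.
Proof.
move=> xC; rewrite leNgt; apply/negP => x0.
have : (0 : R) @[_ --> \oo] --> x.
  by apply: (@geometric_cvg (fun=> 0) x C) => m; rewrite subr0 gtr0_norm.
move=> /(cvg_lim (@Rhausdorff R)); rewrite lim_cst//.
by move=> h; move: x0; rewrite -h ltxx.
Qed.

(** * Integral solutions of linear systems *)

Section system.
Variable n : nat.
Implicit Types (M : 'I_n -> 'I_n -> R -> R) (F Y Z : 'I_n -> R -> R) (c : 'I_n -> R).

Definition mxfun_norm M t := \sum_i \sum_j `|M i j t|.

Definition vecfun_norm Y t := \sum_i `|Y i t|.

Definition L1norm_vec F : R := \sum_i integral_to (fun t => `|F i t|) b.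

Definition rhs M F Y i t := \sum_j M i j t * Y j t + F i t.

Definition solves M F Y := forall i, primitive a b (Y i) (rhs M F Y i).

Lemma mxfun_norm_ge0 M t : 0 <= mxfun_norm M t.
Proof. by apply: sumr_ge0 => i _; exact: sumr_ge0. Qed.

Lemma vecfun_norm_ge0 Y t : 0 <= vecfun_norm Y t.
Proof. exact: sumr_ge0. Qed.

Lemma ler_vecfun_norm Y i t : `|Y i t| <= vecfun_norm Y t.
Proof. by rewrite /vecfun_norm (bigD1 i)//= lerDl sumr_ge0. Qed.

Lemma L1norm_vec_ge0 F : 0 <= L1norm_vec F.
Proof. by apply: sumr_ge0 => i _; exact: integral_to_ge0. Qed.

Lemma L1_mxfun_norm M : (forall i j, L1 (M i j)) -> L1 (mxfun_norm M).
Proof. by move=> Mi; apply: L1_sum => i; apply: L1_sum => j; exact: L1_norm. Qed.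

Lemma bounded_measurable_vecfun_norm Y : (forall i, bounded_measurable (Y i)) ->
  bounded_measurable (vecfun_norm Y).
Proof.
by move=> Yb; apply: bounded_measurable_sum => i; exact: bounded_measurable_norm.
Qed.

Lemma L1_mulmx_vec M Y i : (forall i j, L1 (M i j)) -> (forall i, bounded_measurable (Y i)) ->
  L1 (fun t => \sum_j M i j t * Y j t).
Proof. by move=> Mi Yb; apply: L1_sum => j; exact: L1_mul. Qed.

Lemma L1_rhs M F Y i : (forall i j, L1 (M i j)) -> (forall i, L1 (F i)) ->
  (forall i, bounded_measurable (Y i)) -> L1 (rhs M F Y i).
Proof. by move=> Mi Fi Yb; apply: L1D => //; exact: L1_mulmx_vec. Qed.

Lemma sum_norm_mulmx_le M Y t :
  \sum_i `|\sum_j M i j t * Y j t| <= mxfun_norm M t * vecfun_norm Y t.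
Proof.
rewrite /mxfun_norm mulr_suml; apply: ler_sum => i _.
rewrite (le_trans (ler_norm_sum _ _ _))// mulr_suml; apply: ler_sum => j _.
by rewrite normrM ler_wpM2l// ler_vecfun_norm.
Qed.

Lemma sum_integral_mulmx_le M Y x : (forall i j, L1 (M i j)) ->
  (forall i, bounded_measurable (Y i)) -> x <= b ->
  \sum_i `|integral_to (fun t => \sum_j M i j t * Y j t) x| <=
  integral_to (fun t => mxfun_norm M t * vecfun_norm Y t) x.
Proof.
move=> Mi Yb xb.
rewrite (@le_trans _ _ (\sum_i integral_to (fun t => `|\sum_j M i j t * Y j t|) x))//.
  by apply: ler_sum => i _; rewrite norm_integral_to//; exact: L1_mulmx_vec.
rewrite -integral_to_sum//; last by move=> i; apply: L1_norm; exact: L1_mulmx_vec.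
apply: le_integral_to => //.
- by apply: L1_sum => i; apply: L1_norm; exact: L1_mulmx_vec.
- apply: L1_mul; first exact: bounded_measurable_vecfun_norm.
  exact: L1_mxfun_norm.
- by move=> t _ _; exact: sum_norm_mulmx_le.
Qed.

Lemma solves_bounded_measurable M F Y : solves M F Y -> forall i, bounded_measurable (Y i).
Proof. by move=> Ys i; exact: primitive_bounded_measurable (Ys i). Qed.

(** The forcing is charged with its full norm over [[a, b]], so that the additive term does not
    depend on [x], as [gronwall] requires. *)
Lemma solves_growth M F Y : (forall i j, L1 (M i j)) -> (forall i, L1 (F i)) ->
  solves M F Y -> forall x, a <= x -> x <= b ->
  vecfun_norm Y x <= 2 * (vecfun_norm Y a + L1norm_vec F) * weight (mxfun_norm M) b.
Proof.
move=> Mi Fi Ys x ax xb; have Yb := solves_bounded_measurable Ys.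
have Mn := L1_mxfun_norm Mi.
have c0 : 0 <= vecfun_norm Y a + L1norm_vec F.
  by rewrite addr_ge0 ?vecfun_norm_ge0 ?L1norm_vec_ge0.
apply: (@le_trans _ _ (2 * (vecfun_norm Y a + L1norm_vec F) * weight (mxfun_norm M) x)).
  apply: gronwall ax xb => //.
  - exact: mxfun_norm_ge0.
  - exact: bounded_measurable_vecfun_norm.
  - exact: vecfun_norm_ge0.
  move=> {}x ax xb; rewrite -addrA [L1norm_vec F + _]addrC addrA.
  apply: (@le_trans _ _ (\sum_i (`|Y i a| + `|integral_to (fun t => \sum_j M i j t * Y j t) x|
      + integral_to (fun t => `|F i t|) b))); last first.
    rewrite !big_split /= lerD2r lerD2l; exact: sum_integral_mulmx_le.
  apply: ler_sum => i _; rewrite (Ys i).2// -/(integral_to _ x) integral_toD//; last first.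
    exact: L1_mulmx_vec.
  rewrite addrA; apply: (le_trans (ler_normD _ _)); apply: lerD.
    exact: ler_normD.
  apply: (le_trans (norm_integral_to (Fi i) xb)); apply: integral_to_mono => //.
  exact: L1_norm.
apply: ler_wpM2l; first by rewrite mulr_ge0.
exact: weight_le Mn (mxfun_norm_ge0 M) _ xb.
Qed.

(** Write [M Y - M' Z] as [M (Y - Z) + (M - M') Z]: the change of coefficients is moved into the
    forcing, and estimates known only for [M] apply to the difference. *)
Lemma solvesB M M' F F' Y Z : (forall i j, L1 (M i j)) -> (forall i j, L1 (M' i j)) ->
  solves M F Y -> solves M' F' Z ->
  solves M (fun i t => (F i t - F' i t) + \sum_j (M i j t - M' i j t) * Z j t)
    (fun i t => Y i t - Z i t).
Proof.
move=> Mi M'i Ys Zs i; apply: eq_primitive_deriv (primitiveB (Ys i) (Zs i)) => t _ _.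
rewrite /rhs /= addrCA -big_split/=.
rewrite [in RHS](eq_bigr (fun j => M i j t * Y j t - M' i j t * Z j t)); last first.
  by move=> j _; ring.
by rewrite sumrB; ring.
Qed.

Lemma L1_forcing M M' F F' Z i : (forall i j, L1 (M i j)) -> (forall i j, L1 (M' i j)) ->
  (forall i, L1 (F i)) -> (forall i, L1 (F' i)) -> (forall i, bounded_measurable (Z i)) ->
  L1 (fun t => (F i t - F' i t) + \sum_j (M i j t - M' i j t) * Z j t).
Proof.
move=> Mi M'i Fi F'i Zb; apply: L1D; first exact: L1B.
by apply: L1_sum => j; apply: L1_mul => //; exact: L1B.
Qed.

Lemma primitive_sum (I : Type) (s : seq I) (k : I -> R) (f g : I -> R -> R) :
  (forall l, primitive a b (f l) (g l)) ->
  primitive a b (fun x => \sum_(l <- s) k l * f l x) (fun x => \sum_(l <- s) k l * g l x).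
Proof.
move=> fg; split; first by apply: L1_sum => l; apply: L1Z; exact: (fg l).1.
move=> x ax xb; rewrite -/(integral_to _ x) integral_to_sum//; last first.
  by move=> l; apply: L1Z; exact: (fg l).1.
rewrite -big_split; apply: eq_bigr => l _ /=.
by rewrite integral_toZ; [rewrite (fg l).2// mulrDr|exact: (fg l).1|].
Qed.

Lemma solves_comb M F Y (Z : 'I_n -> 'I_n -> R -> R) c :
  solves M F Y -> (forall l, solves M (fun _ _ => 0) (Z l)) ->
  solves M F (fun i t => Y i t + \sum_l c l * Z l i t).
Proof.
move=> Ys Zs i.
have := primitiveD (Ys i) (primitive_sum (index_enum _) c (fun l => Zs l i)).
apply: eq_primitive_deriv => t _ _; rewrite /rhs /=.
rewrite [in RHS](eq_bigr (fun j => M i j t * Y j t + \sum_l c l * (M i j t * Z l j t))).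
  rewrite big_split/= exchange_big/= addrAC; congr (_ + _ + _).
  by apply: eq_bigr => l _; rewrite addr0 mulr_sumr.
move=> j _; rewrite mulrDr mulr_sumr; congr (_ + _).
by apply: eq_bigr => l _; rewrite mulrCA.
Qed.

(** Picard iteration. By [weight_step] the successive differences, measured against [weight], halve
    at each step on all of [[a, b]], so one global iteration converges without subdividing the
    interval. *)
Lemma initial_value_problem M F c : (forall i j, L1 (M i j)) -> (forall i, L1 (F i)) ->
  exists Y, solves M F Y /\ forall i, Y i a = c i.
Proof.
move=> Mi Fi; pose P Y i x := c i + integral_to (rhs M F Y i) x.
pose X m := iter m P (fun i _ => c i).
have Xb m i : bounded_measurable (X m i).
  elim: m i => [|m IH] i /=; first exact: bounded_measurable_cst.
  apply: primitive_bounded_measurable; apply: primitive_integral_to.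
  exact: L1_rhs.
have Mn := L1_mxfun_norm Mi; have M0 := mxfun_norm_ge0 M.
pose W := weight (mxfun_norm M).
pose dX m : R -> R := vecfun_norm (fun i t => X m.+1 i t - X m i t).
have dXb m : bounded_measurable (dX m).
  by apply: bounded_measurable_vecfun_norm => i; apply: bounded_measurableB; exact: Xb.
have PB Y Z i x : (forall i, bounded_measurable (Y i)) -> (forall i, bounded_measurable (Z i)) ->
    x <= b -> P Y i x - P Z i x = integral_to (fun t => \sum_j M i j t * (Y j t - Z j t)) x.
  move=> Yb Zb xb; rewrite /P opprD addrACA subrr add0r -integral_toB//; last 2 first.
    exact: L1_rhs.
    exact: L1_rhs.
  apply: eq_integral_to => // t _ _; rewrite /rhs opprD addrACA subrr addr0 -sumrB.
  by apply: eq_bigr => j _; rewrite mulrBr.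
have [B0 B00 dX0] : exists2 B : R, 0 <= B & forall t, a <= t -> t <= b -> dX 0 t <= B.
  have [_ [B B0 h]] := dXb 0; exists B => // t at1 tb.
  exact: le_trans (ler_norm _) (h t at1 tb).
have dXm m t : a <= t -> t <= b -> dX m t <= B0 * 2^-1 ^+ m * W t.
  elim: m t => [|m IH] t at1 tb.
    rewrite expr0 mulr1; apply: (le_trans (dX0 t at1 tb)).
    by apply: ler_peMr => //; exact: weight_ge1.
  rewrite exprSr mulrA; apply: le_trans (weight_step Mn M0 (dXb m) _ IH at1 tb); last first.
    by rewrite mulr_ge0// exprn_ge0// invr_ge0.
  apply: le_trans (sum_integral_mulmx_le Mi _ tb); last first.
    by move=> i; apply: bounded_measurableB; exact: Xb.
  apply: ler_sum => i _; rewrite -PB//; exact: Xb.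
pose C := B0 * W b.
have C0 : 0 <= C by rewrite mulr_ge0// ltW// weight_gt0.
have XC i x m : a <= x -> x <= b -> `|X m.+1 i x - X m i x| <= C * 2^-1 ^+ m.
  move=> ax xb; apply: (le_trans (ler_vecfun_norm (fun i t => X m.+1 i t - X m i t) i x)).
  apply: (le_trans (dXm m x ax xb)); rewrite /C mulrAC; apply: ler_wpM2r.
    by rewrite exprn_ge0// invr_ge0.
  by apply: ler_wpM2l => //; exact: weight_le.
have Yex i x : exists l, a <= x <= b -> forall m, `|l - X m i x| <= 2 * C * 2^-1 ^+ m.
  have [/andP[ax xb]|_] := boolP (a <= x <= b); last by exists 0.
  by have [l hl] := geometric_cauchy (fun m => XC i x m ax xb); exists l.
(* The limit is chosen point by point, together with its rate. The rate is uniform in [x], and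
   measurability of [Y] is recovered from pointwise convergence. *)
pose Y i x := xget 0 [set l | a <= x <= b -> forall m, `|l - X m i x| <= 2 * C * 2^-1 ^+ m].
have YX i x m : a <= x -> x <= b -> `|Y i x - X m i x| <= 2 * C * 2^-1 ^+ m.
  move=> ax xb; rewrite /Y; case: xgetP => [l _ /=|/(_ _)/=]; first by rewrite ax xb => /(_ isT).
  by have [l hl] := Yex i x => /(_ l).
have Yb i : bounded_measurable (Y i).
  split.
    apply: (@measurable_fun_cvg _ _ _ _ (fun m => X m i)) => //.
      by move=> m; have [] := Xb m i.
    move=> x /=; rewrite in_itv/= => /andP[ax xb].
    exact: geometric_cvg (fun m => YX i x m ax xb).
  exists (2 * C + `|c i|); first by rewrite addr_ge0// mulr_ge0.
  move=> x ax xb; have := YX i x 0 ax xb; rewrite expr0 mulr1 /= => h.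
  by rewrite -[Y i x](subrK (c i)) (le_trans (ler_normD _ _))// lerD2r.
have YE i x : a <= x -> x <= b -> Y i x = P Y i x.
  move=> ax xb; apply/eqP; rewrite -subr_eq0 -normr_le0.
  (* The comparison goes through [X m.+1], which is [P (X m)]. Both [Y - X m.+1] and [P (X m) - P Y]
     are of order [2^-m]; in the second, each of the [n] components of [X m - Y] is at most
     [2 * C * 2^-m] under the integral. *)
  pose D : R := integral_to (mxfun_norm M) x.
  apply: (@geometric_le0 _ (2 * C + 2 * C *+ n * D)) => m.
  rewrite -(subrKA (X m.+1 i x)) (le_trans (ler_normD _ _))// mulrDl; apply: lerD.
    apply: (le_trans (YX i x m.+1 ax xb)); apply: ler_wpM2l; first by rewrite mulr_ge0.
    by rewrite exprSr ler_piMr ?exprn_ge0 ?invr_ge0// invf_le1// ler1n.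
  rewrite [X in `|X|](PB _ _ _ _ (Xb m) Yb xb).
  have XYb j : bounded_measurable (fun t => X m j t - Y j t) by apply: bounded_measurableB.
  apply: (@le_trans _ _ (integral_to (fun t => mxfun_norm M t * vecfun_norm (fun j t => X m j t - Y j t) t) x)).
    apply: le_trans (sum_integral_mulmx_le Mi XYb xb).
    by rewrite (bigD1 i)//= lerDl sumr_ge0.
  rewrite -mulrA [D * _]mulrC mulrA -integral_toZ//; apply: le_integral_to => //.
  - by apply: L1_mul => //; exact: bounded_measurable_vecfun_norm.
  - exact: L1Z.
  - move=> t at1 tb; rewrite mulrC ler_wpM2r//.
    rewrite mulrnAl -[n in X in _ <= X]card_ord -sumr_const; apply: ler_sum => j _.
    by rewrite distrC; exact: YX.
exists Y; split => [i|i]; last by rewrite YE// /P integral_to_start addr0.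
have := primitive_integral_to (c i) (L1_rhs i Mi Fi Yb).
by apply: eq_primitive => // x ax xb; rewrite YE.
Qed.

(** * Boundary value problems and their perturbation *)

Section boundary_value_problem.
Variables (P Q : 'M[R]_n).

Definition boundary Y : 'cV[R]_n := P *m (\col_i Y i a) + Q *m (\col_i Y i b).

Definition uniquely_solvable M := forall Y, solves M (fun _ _ => 0) Y ->
  boundary Y = 0 -> forall i x, a <= x -> x <= b -> Y i x = 0.

Lemma L1norm_vec0 : L1norm_vec (fun _ _ => 0) = 0.
Proof.
rewrite /L1norm_vec big1// => j _; rewrite (@eq_integral_to _ (fun=> 0))//; last first.
  by move=> *; rewrite normr0.
by rewrite /integral_to /Rintegral integral0.
Qed.

Lemma solves_eq0 M Y : (forall i j, L1 (M i j)) -> solves M (fun _ _ => 0) Y ->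
  (forall i, Y i a = 0) -> forall i x, a <= x -> x <= b -> Y i x = 0.
Proof.
move=> Mi Ys Ya i x ax xb; apply/eqP; rewrite -normr_le0.
apply: (le_trans (ler_vecfun_norm Y i x)).
apply: (le_trans (solves_growth Mi (fun=> L10) Ys ax xb)).
rewrite (_ : vecfun_norm Y a = 0); last first.
  by rewrite /vecfun_norm big1// => j _; rewrite Ya normr0.
by rewrite L1norm_vec0 addr0 mulr0 mul0r.
Qed.

Lemma fundamental_system M : (forall i j, L1 (M i j)) ->
  exists Z : 'I_n -> 'I_n -> R -> R,
    forall l, solves M (fun _ _ => 0) (Z l) /\ forall i, Z l i a = (i == l)%:R.
Proof.
move=> Mi; have h (l : 'I_n) := initial_value_problem (fun i => (i == l)%:R) Mi (fun=> L10).
by have [Z ZP] := choice h; exists Z.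
Qed.

Section fundamental.
Variables (M : 'I_n -> 'I_n -> R -> R) (Z : 'I_n -> 'I_n -> R -> R).
Hypothesis (Mi : forall i j, L1 (M i j)).
Hypothesis (Zs : forall l, solves M (fun _ _ => 0) (Z l)).
Hypothesis (Za : forall l i, Z l i a = (i == l)%:R).

Let Phi : 'M[R]_n := \matrix_(i, l) Z l i b.

Lemma comb_start c i : \sum_l c l * Z l i a = c i.
Proof.
rewrite (bigD1 i)//= Za eqxx mulr1 big1 ?addr0// => l li.
by rewrite Za eq_sym (negbTE li) mulr0.
Qed.

Lemma boundary_comb Y c :
  boundary (fun i t => Y i t + \sum_l c l * Z l i t) =
  boundary Y + (P + Q *m Phi) *m (\col_l c l).
Proof.
have ea : \col_i (Y i a + \sum_l c l * Z l i a) = \col_i Y i a + \col_l c l.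
  by apply/colP => i; rewrite !mxE comb_start.
have eb : \col_i (Y i b + \sum_l c l * Z l i b) = \col_i Y i b + Phi *m \col_l c l.
  apply/colP => i; rewrite !mxE; congr (_ + _).
  by apply: eq_bigr => l _; rewrite !mxE mulrC.
by rewrite /boundary ea eb !mulmxDr mulmxDl mulmxA addrACA.
Qed.

Lemma boundary0 : boundary (fun _ _ => 0) = 0.
Proof.
rewrite /boundary (_ : \col__ 0 = 0) ?mulmx0 ?addr0//.
by apply/colP => i; rewrite !mxE.
Qed.

Lemma solves0 : solves M (fun _ _ => 0) (fun _ _ => 0).
Proof.
move=> i; split; last by move=> x _ _; rewrite -/(integral_to _ x) /rhs
  (_ : (fun _ => _) = fun=> 0) ?/integral_to ?/Rintegral ?integral0 ?addr0//;
  apply/funext => t; rewrite big1 ?addr0// => j _; rewrite mulr0.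
by apply: eq_L1 L10 => t _ _; rewrite /rhs big1 ?addr0// => j _; rewrite mulr0.
Qed.

(** A kernel vector [v] of this matrix makes the combination of the [Z l] with coefficients [v] a
    homogeneous solution satisfying the boundary condition. It vanishes by uniqueness, and its value
    at [a] is [v]. The transpose appears because [kermx] is a left kernel. *)
Lemma boundary_matrix_unit : uniquely_solvable M -> P + Q *m Phi \in unitmx.
Proof.
move=> us; set D := _ + _; rewrite -unitmx_tr -row_free_unit -kermx_eq0.
apply/negPn/negP => /rowV0Pn[v /sub_kermxP vD v0].
have Ds : D *m (\col_l v 0 l) = 0.
  apply: trmx_inj; rewrite trmx_mul trmx0 -vD; congr (_ *m _).
  by apply/rowP => l; rewrite !mxE.
have := us (fun i t => 0 + \sum_l v 0 l * Z l i t) (solves_comb (v 0) solves0 Zs).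
rewrite boundary_comb boundary0 add0r => /(_ Ds) h.
move/eqP: v0; apply; apply/rowP => i; have := h i a (lexx _) leab.
by rewrite add0r comb_start mxE.
Qed.

End fundamental.

Lemma boundary_value_problem M F : (forall i j, L1 (M i j)) -> (forall i, L1 (F i)) ->
  uniquely_solvable M -> exists Y, solves M F Y /\ boundary Y = 0.
Proof.
move=> Mi Fi us; have [Z ZP] := fundamental_system Mi.
have Zs l := (ZP l).1; have Za l := (ZP l).2.
have Du := boundary_matrix_unit Zs Za us.
have [Y [Ys Ya]] := initial_value_problem (fun=> 0) Mi Fi.
(* Adding the homogeneous solution with initial value [d] changes the boundary value by [D *m d], so
   this [d] cancels [boundary Y]. *)
set D := _ + _ in Du; pose d := - (invmx D *m boundary Y).
exists (fun i t => Y i t + \sum_l d l 0 * Z l i t); split.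
  exact: (solves_comb (fun l => d l 0)).
rewrite boundary_comb// -/D (_ : \col_l _ = d); last by apply/colP => i; rewrite mxE.
by rewrite /d mulmxN mulKVmx ?subrr.
Qed.

Lemma boundary_value_bound M : (forall i j, L1 (M i j)) -> uniquely_solvable M ->
  exists2 K : R, 0 <= K & forall F Y, (forall i, L1 (F i)) -> solves M F Y ->
    boundary Y = 0 -> forall x, a <= x -> x <= b -> vecfun_norm Y x <= K * L1norm_vec F.
Proof.
move=> Mi us; have [Z ZP] := fundamental_system Mi.
have Zs l := (ZP l).1; have Za l := (ZP l).2.
have Du := boundary_matrix_unit Zs Za us; set D := _ + _ in Du.
pose w := weight (mxfun_norm M) b.
have w0 : 0 <= w by exact/ltW/weight_gt0.
pose q := \sum_i \sum_j `|(invmx D *m Q) i j|.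
have q0 : 0 <= q by apply: sumr_ge0 => i _; exact: sumr_ge0.
(* Write [Y] as [Y0], which starts at 0, plus a homogeneous solution. The boundary condition forces
   [Y a = - D^-1 Q (Y0 b)]. The growth estimate for [Y0] gives [2 * w], the matrix gives [q], and a
   second growth estimate, now for [Y], gives the outer [2] and [w]. *)
exists (2 * (q * (2 * w) + 1) * w).
  by rewrite !mulr_ge0// addr_ge0// !mulr_ge0.
move=> F Y Fi Ys bY x ax xb; have F0 := L1norm_vec_ge0 F.
have [Y0 [Y0s Y0a]] := initial_value_problem (fun=> 0) Mi Fi.
have Y0b : vecfun_norm Y0 b <= 2 * w * L1norm_vec F.
  apply: (le_trans (solves_growth Mi Fi Y0s leab (lexx b))).
  rewrite (_ : vecfun_norm Y0 a = 0) ?add0r; first by rewrite mulrAC.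
  by rewrite /vecfun_norm big1// => i _; rewrite Y0a normr0.
pose c i := Y i a.
have YE i t : a <= t -> t <= b -> Y i t = Y0 i t + \sum_l c l * Z l i t.
  move=> at1 tb; apply/eqP; rewrite -subr_eq0; apply/eqP.
  have H := solvesB Mi Mi Ys (solves_comb c Y0s Zs).
  apply: (@solves_eq0 M (fun i t => Y i t - (Y0 i t + \sum_l c l * Z l i t))) => // j.
    apply: eq_primitive_deriv (H j) => u _ _; rewrite /rhs subrr add0r.
    by rewrite [X in _ + X]big1 // => l _; rewrite subrr mul0r.
  by rewrite Y0a add0r comb_start// subrr.
have bE : boundary Y = boundary (fun i t => Y0 i t + \sum_l c l * Z l i t).
  have Yab t : a <= t -> t <= b ->
      \col_i Y i t = \col_i (Y0 i t + \sum_l c l * Z l i t).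
    by move=> at1 tb; apply/colP => i; rewrite !mxE YE.
  by rewrite /boundary (Yab a)// (Yab b).
have cE : \col_i c i = - (invmx D *m Q *m (\col_i Y0 i b)).
  apply/eqP; rewrite -addr_eq0; apply/eqP.
  move: bY; rewrite bE boundary_comb// -/D => /(congr1 (mulmx (invmx D))).
  rewrite mulmx0 mulmxDr mulKmx// => <-; rewrite addrC; congr (_ + _).
  rewrite /boundary (_ : \col_i Y0 i a = 0) ?mulmx0 ?add0r ?mulmxA//.
  by apply/colP => i; rewrite !mxE Y0a.
have cq : vecfun_norm Y a <= q * (2 * w * L1norm_vec F).
  apply: (@le_trans _ _ (q * vecfun_norm Y0 b)); last by rewrite ler_wpM2l.
  rewrite /vecfun_norm /q mulr_suml; apply: ler_sum => i _.
  have -> : Y i a = (\col_i c i) i 0 by rewrite mxE.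
  rewrite cE !mxE normrN (le_trans (ler_norm_sum _ _ _))// mulr_suml.
  apply: ler_sum => j _; rewrite [X in _ * X]mxE normrM ler_wpM2l//.
  exact: ler_vecfun_norm.
apply: (le_trans (solves_growth Mi Fi Ys ax xb)); rewrite -/w.
have -> : 2 * (q * (2 * w) + 1) * w * L1norm_vec F =
    2 * (q * (2 * w * L1norm_vec F) + L1norm_vec F) * w by ring.
by rewrite ler_wpM2r// ler_wpM2l// lerD2r.
Qed.

Lemma boundaryB Y Z : boundary (fun i t => Y i t - Z i t) = boundary Y - boundary Z.
Proof.
have h t : \col_i (Y i t - Z i t) = \col_i Y i t - \col_i Z i t.
  by apply/colP => i; rewrite !mxE.
by rewrite /boundary !h !mulmxBr addrACA opprD.
Qed.

(* Y - Z solves the unperturbed problem with forcing term (M - M') Z, so the a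
   priori bound of that problem alone controls it. *)
Lemma boundary_value_perturbation M M' (K : R) :
  (forall i j, L1 (M i j)) -> (forall i j, L1 (M' i j)) -> 0 <= K ->
  (forall F Y, (forall i, L1 (F i)) -> solves M F Y -> boundary Y = 0 ->
    forall x, a <= x -> x <= b -> vecfun_norm Y x <= K * L1norm_vec F) ->
  let eps := integral_to (mxfun_norm (fun i j t => M i j t - M' i j t)) b in
  K * eps <= 2^-1 ->
  forall F Y Z, (forall i, L1 (F i)) -> solves M F Y -> boundary Y = 0 ->
    solves M' F Z -> boundary Z = 0 ->
    forall x, a <= x -> x <= b ->
      vecfun_norm (fun i t => Y i t - Z i t) x <= 2 * (K * eps * (K * L1norm_vec F)).
Proof.
move=> Mi M'i K0 HK eps Ke F Y Z Fi Ys Yb Zs Zb.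
have Yb' := solves_bounded_measurable Ys; have Zb' := solves_bounded_measurable Zs.
set D := fun i t => Y i t - Z i t.
have Di i : bounded_measurable (D i) by exact: bounded_measurableB.
have Db : boundary D = 0 by rewrite boundaryB Yb Zb subrr.
have Ds := solvesB Mi M'i Ys Zs.
have MMi i j : L1 (fun t => M i j t - M' i j t) by exact: L1B.
have eps0 : 0 <= eps by apply: integral_to_ge0 => t; exact: mxfun_norm_ge0.
have F0 := L1norm_vec_ge0 F.
have HD := HK _ _ (fun i => L1_forcing i Mi M'i Fi Fi Zb') Ds Db.
apply: absorb.
- exact: vecfun_norm_ge0.
- have [_ [B _ h]] := bounded_measurable_vecfun_norm Di.
  by exists B => x ax xb; exact: le_trans (ler_norm _) (h x ax xb).
(* If the difference is at most [B], then [Z] is at most [K * L1norm_vec F + B], and the forcing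
   [(M - M') Z] has norm at most [eps] times that. The part [K * eps * B] is at most [B / 2], which
   is the form that [absorb] expects. *)
move=> B B0 DB x ax xb; apply: (le_trans (HD x ax xb)).
apply: (@le_trans _ _ (K * (eps * (K * L1norm_vec F + B)))); last first.
  rewrite mulrA mulrDr lerD2l; apply: (@le_trans _ _ (2^-1 * B)).
    by rewrite ler_wpM2r.
  by rewrite mulrC.
rewrite ler_wpM2l//.
apply: (@le_trans _ _ (integral_to (fun t => (K * L1norm_vec F + B) *
    mxfun_norm (fun i j t => M i j t - M' i j t) t) b)); last first.
  by rewrite integral_toZ ?lexx//; [rewrite mulrC|exact: L1_mxfun_norm].
rewrite /L1norm_vec -integral_to_sum//; last first.
  by move=> i; apply: L1_norm; exact: L1_forcing.
apply: le_integral_to => //.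
- by apply: L1_sum => i; apply: L1_norm; exact: L1_forcing.
- by apply: L1Z; exact: L1_mxfun_norm.
move=> t at1 tb.
rewrite (eq_bigr (fun i => `|\sum_j (M i j t - M' i j t) * Z j t|)); last first.
  by move=> i _; rewrite subrr add0r.
apply: (le_trans (sum_norm_mulmx_le (fun i j t => M i j t - M' i j t) Z t)).
rewrite mulrC ler_wpM2r ?mxfun_norm_ge0//.
apply: (@le_trans _ _ (vecfun_norm Y t + vecfun_norm D t)); last first.
  by apply: lerD; [exact: HK|exact: DB].
rewrite /vecfun_norm -big_split; apply: ler_sum => i _ /=.
by rewrite -[Z i t](subKr (Y i t)); exact: ler_normB.
Qed.

(** The perturbation estimate with [F = 0] and [Y = 0] bounds every homogeneous solution [Z] of the
    perturbed problem by 0. *)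
Lemma uniquely_solvable_perturbation M M' (K : R) :
  (forall i j, L1 (M i j)) -> (forall i j, L1 (M' i j)) -> 0 <= K ->
  (forall F Y, (forall i, L1 (F i)) -> solves M F Y -> boundary Y = 0 ->
    forall x, a <= x -> x <= b -> vecfun_norm Y x <= K * L1norm_vec F) ->
  K * integral_to (mxfun_norm (fun i j t => M i j t - M' i j t)) b <= 2^-1 ->
  uniquely_solvable M'.
Proof.
move=> Mi M'i K0 HK Ke Z Zs Zb i x ax xb; apply/eqP; rewrite -normr_le0.
have := boundary_value_perturbation Mi M'i K0 HK Ke (fun=> L10)
  (solves0 M) boundary0 Zs Zb ax xb.
rewrite L1norm_vec0 !mulr0; apply: le_trans.
by apply: le_trans (ler_vecfun_norm _ i x); rewrite sub0r normrN.
Qed.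

End boundary_value_problem.
End system.
End LinearSystems.
(** * Complex pairs as real vectors *)

Section ComplexFunctions.
Local Open Scope complex_scope.
Context {R : realType}.
Local Notation mu := (@lebesgue_measure R).
Local Notation Re := (@complex.Re R).
Local Notation Im := (@complex.Im R).
Implicit Types (a b : R) (z w : R[i]) (y u : R -> R[i]).

Lemma ReD z w : Re (z + w) = Re z + Re w. Proof. by case: z; case: w. Qed.
Lemma ImD z w : Im (z + w) = Im z + Im w. Proof. by case: z; case: w. Qed.
Lemma ReN z : Re (- z) = - Re z. Proof. by case: z. Qed.
Lemma ImN z : Im (- z) = - Im z. Proof. by case: z. Qed.
Lemma ReB z w : Re (z - w) = Re z - Re w. Proof. by rewrite ReD ReN. Qed.
Lemma ImB z w : Im (z - w) = Im z - Im w. Proof. by rewrite ImD ImN. Qed.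
Lemma ReM z w : Re (z * w) = Re z * Re w - Im z * Im w.
Proof. by case: z; case: w. Qed.
Lemma ImM z w : Im (z * w) = Re z * Im w + Im z * Re w.
Proof. by case: z; case: w. Qed.

Lemma eq_ReIm z w : Re z = Re w -> Im z = Im w -> z = w.
Proof. by case: z w => [x1 x2] [y1 y2] /= -> ->. Qed.

Lemma normc_sqr z : Normc.normc z ^+ 2 = Re z ^+ 2 + Im z ^+ 2.
Proof. by case: z => x y /=; rewrite sqr_sqrtr// addr_ge0// sqr_ge0. Qed.

Lemma normr_Re_le_normc z : `|Re z| <= Normc.normc z.
Proof.
have n0 : 0 <= Normc.normc z by case: z => x y; exact: sqrtr_ge0.
by rewrite -(ler_pXn2r (ltn0Sn 1)) ?nnegrE// real_normK ?num_real// normc_sqr lerDl sqr_ge0.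
Qed.

Lemma normr_Im_le_normc z : `|Im z| <= Normc.normc z.
Proof.
have n0 : 0 <= Normc.normc z by case: z => x y; exact: sqrtr_ge0.
by rewrite -(ler_pXn2r (ltn0Sn 1)) ?nnegrE// real_normK ?num_real// normc_sqr lerDr sqr_ge0.
Qed.

Lemma normc_le_ReIm z : Normc.normc z <= `|Re z| + `|Im z|.
Proof.
have n0 : 0 <= Normc.normc z by case: z => x y; exact: sqrtr_ge0.
rewrite -(ler_pXn2r (ltn0Sn 1)) ?nnegrE ?addr_ge0// normc_sqr sqrrD !real_normK ?num_real//.
by rewrite lerD2r lerDl mulrn_wge0// mulr_ge0.
Qed.

Lemma abs_continuous_ac a b y : abs_continuous a b y ->
  ac a b (Re \o y) /\ ac a b (Im \o y).
Proof.
move=> yac; split; apply: acP => e e0; have [d d0 H] := yac e e0; exists d => // n u v uv tI ud;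
  apply: le_lt_trans (H n u v uv tI ud); apply: ler_sum => i _ /=.
  by rewrite -ReB; exact: normr_Re_le_normc.
by rewrite -ImB; exact: normr_Im_le_normc.
Qed.

Lemma primitive_abs_continuous a b y g1 g2 : primitive a b (Re \o y) g1 ->
  primitive a b (Im \o y) g2 -> abs_continuous a b y.
Proof.
move=> /primitive_uniformly_small P1 /primitive_uniformly_small P2 e e0.
have e2 : 0 < e / 2 by rewrite divr_gt0.
have [d1 d10 H1] := P1 _ e2; have [d2 d20 H2] := P2 _ e2.
exists (Num.min d1 d2); first by rewrite lt_min d10.
move=> n u v uv tI; rewrite lt_min => /andP[ud1 ud2].
rewrite [e]splitr; apply: le_lt_trans (ltrD (H1 n u v uv tI ud1) (H2 n u v uv tI ud2)).
rewrite -big_split; apply: ler_sum => i _ /=.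
by rewrite -ReB -ImB; exact: normc_le_ReIm.
Qed.

(* A complex pair (y, u) is encoded by (Re y, Im y, Re u, Im u). *)
Definition realmx (A : 'M[R[i]]_2) : 'M[R]_4 := \matrix_(i, j)
  let z := A (inord i./2) (inord j./2) in
  if odd i then (if odd j then Re z else Im z) else (if odd j then - Im z else Re z).

Definition realcv (v : 'cV[R[i]]_2) : 'cV[R]_4 := \col_i
  let z := v (inord i./2) 0 in if odd i then Im z else Re z.

Lemma realcv_mul (A : 'M[R[i]]_2) v : realcv (A *m v) = realmx A *m realcv v.
Proof.
apply/colP => i; rewrite !mxE !big_ord_recl !big_ord0 !mxE /=.
have -> : inord 0 = ord0 :> 'I_2 by apply/val_inj; rewrite /= inordK.
have -> : inord 1 = lift ord0 ord0 :> 'I_2 by apply/val_inj; rewrite /= inordK.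
rewrite -/(0 : 'I_1); case: (odd i); rewrite !addr0 ?(ImD, ReD, ImM, ReM);
  rewrite ?addr0; ring.
Qed.

Lemma realcvD (v w : 'cV[R[i]]_2) : realcv (v + w) = realcv v + realcv w.
Proof. by apply/colP => i; rewrite !mxE /=; case: (odd i); rewrite ?(ReD, ImD). Qed.

Lemma realcv_eq0 (v : 'cV[R[i]]_2) : realcv v = 0 -> v = 0.
Proof.
move=> v0; apply/colP => i; rewrite mxE; apply: eq_ReIm.
  have := congr1 (fun w : 'cV[R]_4 => w (inord i.*2) 0) v0; rewrite !mxE.
  have i2 : (i.*2 < 4)%N by case: i => [[|[|]]].
  by rewrite inordK// odd_double doubleK inord_val.
have := congr1 (fun w : 'cV[R]_4 => w (inord i.*2.+1) 0) v0; rewrite !mxE.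
have i2 : (i.*2.+1 < 4)%N by case: i => [[|[|]]].
by rewrite inordK//= odd_double /= uphalf_double inord_val.
Qed.

Lemma realcv0 : realcv 0 = 0.
Proof. by apply/colP => i; rewrite !mxE /=; case: (odd i). Qed.

Definition real_vecfun y u (i : 'I_4) (t : R) : R :=
  nth 0 [:: Re (y t); Im (y t); Re (u t); Im (u t)] i.

Lemma real_vecfun_col y u t : \col_i real_vecfun y u i t = realcv (vec2 (y t) (u t)).
Proof.
apply/colP => i; rewrite !mxE; case: i => [[|[|[|[|//]]]] ?] /=;
  by rewrite -val_eqE /= inordK.
Qed.

Lemma boundary_real_vecfun a b (A B : 'M[R[i]]_2) y u :
  boundary a b (realmx A) (realmx B) (real_vecfun y u) = 0 <->
  A *m vec2 (y a) (u a) + B *m vec2 (y b) (u b) = 0.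
Proof.
rewrite /boundary !real_vecfun_col -!realcv_mul -realcvD.
by split => [/realcv_eq0//|->]; exact: realcv0.
Qed.

End ComplexFunctions.
(** * Self-adjoint boundary conditions *)

Section SelfAdjointBoundaryConditions.
Local Open Scope complex_scope.
Context {R : realType}.
Local Notation Re := (@complex.Re R).
Local Notation Im := (@complex.Im R).
Local Notation E := (@symplectic_mx R).

(** The conjugate transpose [adjoint_mx], extended to rectangular shapes so that it applies to
    vectors and to the block [row_mx A B]. *)
Definition adj m n (M : 'M[R[i]]_(m, n)) : 'M[R[i]]_(n, m) := map_mx (@conjc R) M^T.

Lemma adjM m n k (M : 'M[R[i]]_(m, n)) (N : 'M[R[i]]_(n, k)) :
  adj (M *m N) = adj N *m adj M.
Proof. by rewrite /adj trmx_mul map_mxM. Qed.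

Lemma adjK m n (M : 'M[R[i]]_(m, n)) : adj (adj M) = M.
Proof. by apply/matrixP => i j; rewrite !mxE conjcK. Qed.

Lemma mxrank_adj m n (M : 'M[R[i]]_(m, n)) : \rank (adj M) = \rank M.
Proof. by rewrite /adj mxrank_map mxrank_tr. Qed.

Lemma symplectic_mx_sqr : E *m E = - 1%:M.
Proof.
apply/matrixP => i j; rewrite !mxE !big_ord_recl big_ord0 !mxE.
by case: i => [[|[|//]] ?]; case: j => [[|[|//]] ?] /=; ring.
Qed.

Lemma adj_symplectic_mx : adj E = - E.
Proof.
apply/matrixP => i j; rewrite !mxE.
by case: i => [[|[|//]] ?]; case: j => [[|[|//]] ?] /=;
  apply: eq_ReIm => //=; ring.
Qed.

(* The columns of K span the kernel of (A|B): they lie in it because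
   A E A^* = B E B^*, and both have dimension 2. *)
Lemma selfadjoint_bc_param (A B : 'M[R[i]]_2) (va vb : 'cV[R[i]]_2) :
  selfadjoint_bc A B -> A *m va + B *m vb = 0 ->
  exists x : 'cV[R[i]]_2, va = E *m adj A *m x /\ vb = - (E *m adj B) *m x.
Proof.
move=> [rAB AB] vAB; set N := row_mx A B in rAB.
pose K := col_mx (E *m adj A) (- (E *m adj B)).
have NK : N *m K = 0 by rewrite mul_row_col mulmxN !mulmxA -AB subrr.
have KN : (K^T <= kermx N^T)%MS by apply/sub_kermxP; rewrite -trmx_mul NK trmx0.
have rK : (2 <= \rank K^T)%N.
  have /eq_leq := esym rAB; rewrite mxrank_tr -mxrank_adj => /leq_trans; apply.
  (* As [E *m E] is minus the identity, the blocks [- E] and [E] undo the factors [E] and [- E] in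
     [K]. Hence [K] has at least the rank of [adj N], which is 2. *)
  have -> : adj N = block_mx (- E) 0 0 E *m K.
    rewrite mul_block_col !mul0mx addr0 add0r mulNmx mulmxN !mulmxA symplectic_mx_sqr.
    by rewrite !mulNmx !opprK !mul1mx /adj tr_row_mx map_col_mx.
  exact: mxrankM_maxr.
have rker : \rank (kermx N^T) = 2%N by rewrite mxrank_ker mxrank_tr rAB.
have := mxrank_leqif_eq KN; rewrite rker => -[rK2 rKE].
have : (\rank K^T == 2)%N by rewrite eqn_leq rK2 rK.
rewrite rKE => /andP[_ kerK].
have : ((col_mx va vb)^T <= kermx N^T)%MS.
  by apply/sub_kermxP; rewrite -trmx_mul mul_row_col vAB trmx0.
move=> /submx_trans/(_ kerK)/submxP[D DE].
exists D^T; apply: eq_col_mx; rewrite -mul_col_mx -/K -[col_mx va vb]trmxK DE.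
by rewrite trmx_mul trmxK.
Qed.

(** Under the parametrisation of the kernel by [x], the two sides become the values at [x] of the
    forms with matrices [A *m E *m adj A] and [B *m E *m adj B], which coincide. *)
Lemma selfadjoint_bc_form (A B : 'M[R[i]]_2) (va vb : 'cV[R[i]]_2) :
  selfadjoint_bc A B -> A *m va + B *m vb = 0 ->
  adj va *m E *m va = adj vb *m E *m vb.
Proof.
move=> AB /(selfadjoint_bc_param AB)[x [-> ->]].
have EEE M (N : 'M[R[i]]_(2, 1)) : adj (M *m N) *m E *m (M *m N) =
    adj N *m (adj M *m E *m M) *m N by rewrite adjM !mulmxA.
have sym (A' : 'M[R[i]]_2) : adj (E *m adj A') *m E *m (E *m adj A') = A' *m E *m adj A'.
  have h : A' *m - E *m E = A' by rewrite -mulmxA mulNmx symplectic_mx_sqr opprK mulmx1.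
  by rewrite adjM adjK adj_symplectic_mx h mulmxA.
rewrite !EEE sym.
have -> : adj (- (E *m adj B)) = - adj (E *m adj B).
  by apply/matrixP => i j; rewrite !mxE rmorphN.
by rewrite !mulNmx mulmxN opprK sym; case: AB => _ ->.
Qed.

(** This is -2 times the imaginary part of the conjugate of [z] times [w]: for the values of
    [(y, u)] at an endpoint, the boundary term of the Lagrange identity. *)
Lemma vec2_form (z w : R[i]) :
  Im ((adj (vec2 z w) *m E *m vec2 z w) 0 0) = 2 * (Im z * Re w - Re z * Im w).
Proof.
rewrite !mxE !big_ord_recl big_ord0 !mxE !big_ord_recl !big_ord0 !mxE /=.
case: z => z1 z2; case: w => w1 w2.
by rewrite !(ImD, ReD, ImM, ReM, ReN, ImN) /=; ring.
Qed.

End SelfAdjointBoundaryConditions.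
(** * Sturm-Liouville operators and their resolvents *)

Section SturmLiouvilleOperators.
Local Open Scope complex_scope.
Context {R : realType}.
Local Notation mu := (@lebesgue_measure R).
Local Notation Re := (@complex.Re R).
Local Notation Im := (@complex.Im R).
Implicit Types (y u : R -> R[i]).

(** * Weighted square-integrable functions *)

Section WeightedL2.
Variables (a b : R) (r : R -> R).
Hypotheses (ab : a < b) (hr : inL1 a b r) (r_gt0 : ae_pos a b r).
Implicit Types (f g h : R -> R[i]).
Let leab : a <= b := ltW ab.

(** Coefficients are given on the open interval, while systems are solved on the closed one; adding
    the two endpoints affects neither measurability nor integrals. *)
Lemma inL1_L1 (g : R -> R) : inL1 a b g -> L1 a b g.
Proof.
rewrite /inL1 => /integrableP[mg gi]; apply/integrableP; split.
  by apply/emeasurable_fun_itv_obnd_cbndP; apply/emeasurable_fun_itv_bndo_bndcP.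
rewrite (integral_itv_bndoo (f := fun x => `|(EFin \o g) x|%E))//.
exact: measurableT_comp.
Qed.

Lemma L1_inL1 (g : R -> R) : L1 a b g -> inL1 a b g.
Proof. by move=> gi; apply: integrableS gi => //; exact: subset_itv_oo_cc. Qed.

Lemma Rintegral_itvoo (g : R -> R) : inL1 a b g ->
  \int[mu]_(x in `]a, b[) g x = integral_to a g b.
Proof.
move=> /integrableP[mg _]; rewrite /integral_to /Rintegral; congr fine.
by rewrite [RHS](integral_itv_bndoo (f := EFin \o g)).
Qed.

Lemma eq_Rintegral_itvoo (f g : R -> R) : {ae mu, forall x, x \in `]a, b[ -> f x = g x} ->
  measurable_fun `]a, b[ f -> measurable_fun `]a, b[ g ->
  \int[mu]_(x in `]a, b[) f x = \int[mu]_(x in `]a, b[) g x.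
Proof.
move=> fg mf mg; rewrite /Rintegral; congr fine; apply: ae_eq_integral => //.
- exact/measurable_EFinP.
- exact/measurable_EFinP.
- by apply: ae_mono fg => x h xab; congr EFin; exact: h.
Qed.

Definition weighted_sqr_norm f x : R := Normc.normc (f x) ^+ 2 * r x.

Definition re_im_measurable f :=
  measurable_fun `]a, b[ (Re \o f) /\ measurable_fun `]a, b[ (Im \o f).

Lemma measurable_weight : measurable_fun `]a, b[ r.
Proof. by have /integrableP[/measurable_EFinP] := hr. Qed.

Lemma measurable_weighted_sqr_norm f : re_im_measurable f ->
  measurable_fun `]a, b[ (weighted_sqr_norm f).
Proof.
move=> [mRe mIm]; apply: measurable_funM; last exact: measurable_weight.
rewrite (_ : (fun x => _) = fun x => (Re (f x)) ^+ 2 + (Im (f x)) ^+ 2); last first.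
  by apply/funext => x; rewrite normc_sqr.
by apply: measurable_funD; apply: measurable_funX.
Qed.

(** The integral in [inL2r] carries no absolute value; its finiteness amounts to integrability
    because [r > 0] a.e. makes the integrand nonnegative a.e. *)
Lemma inL2rP f : inL2r a b r f <->
  re_im_measurable f /\ inL1 a b (weighted_sqr_norm f).
Proof.
split=> [[mRe mIm fi]|[[mRe mIm] fi]].
  have mf : re_im_measurable f by [].
  split => //; apply/integrableP; split.
    by apply/measurable_EFinP; exact: measurable_weighted_sqr_norm.
  apply: le_lt_trans fi; rewrite le_eqVlt; apply/orP; left; apply/eqP.
  apply: ae_eq_integral => //.
  - by do 2 apply: measurableT_comp => //; exact: measurable_weighted_sqr_norm.
  - by apply: measurableT_comp => //; exact: measurable_weighted_sqr_norm.
  - apply: ae_mono r_gt0 => x r0 xab; rewrite /= ger0_norm// mulr_ge0 ?sqr_ge0//.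
    exact/ltW/r0.
split => //; have /integrableP[mf fioo] := fi.
have : (\int[mu]_(x in `]a, b[) (weighted_sqr_norm f x)%:E)%E \is a fin_num.
  exact: integrable_fin_num.
by rewrite fin_numElt => /andP[].
Qed.

Lemma L2r_norm_ae_le f (C : R) : re_im_measurable f -> 0 <= C ->
  {ae mu, forall x, x \in `]a, b[ -> Normc.normc (f x) <= C} ->
  L2r_norm a b r f <= C * Num.sqrt (integral_to a (fun x => `|r x|) b).
Proof.
move=> mf C0 fC; have I0 : 0 <= integral_to a (fun x => `|r x|) b.
  by apply: integral_to_ge0.
have -> : C * Num.sqrt (integral_to a (fun x => `|r x|) b) =
    Num.sqrt (C ^+ 2 * integral_to a (fun x => `|r x|) b).
  by rewrite sqrtrM ?sqr_ge0// sqrtr_sqr ger0_norm.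
have ri : inL1 a b (fun x => C ^+ 2 * `|r x|).
  by apply: L1_inL1; apply: L1Z; apply: L1_norm; exact: inL1_L1.
rewrite /L2r_norm; apply: ler_wsqrtr; rewrite -(@integral_toZ _ a b)//; last first.
  by apply: L1_norm; exact: inL1_L1.
rewrite -Rintegral_itvoo//.
(* The bound on [f] and the sign of [r] hold only a.e. The truncation [g] agrees a.e. with the
   integrand and is dominated everywhere by the integrable [C ^+ 2 * |r|], which gives both its
   integrability and the comparison. *)
pose g x := Num.min (Normc.normc (f x) ^+ 2) (C ^+ 2) * `|r x|.
have mn : measurable_fun `]a, b[ (fun x => Normc.normc (f x) ^+ 2).
  rewrite (_ : (fun x => _) = fun x => (Re (f x)) ^+ 2 + (Im (f x)) ^+ 2); last first.
    by apply/funext => x; rewrite normc_sqr.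
  by apply: measurable_funD; apply: measurable_funX; [exact: mf.1|exact: mf.2].
have mg : measurable_fun `]a, b[ g.
  apply: measurable_funM; first exact: measurable_minr.
  by apply: measurableT_comp => //; exact: measurable_weight.
rewrite (@eq_Rintegral_itvoo _ g)//; last first.
- exact: measurable_weighted_sqr_norm.
- apply: ae_mono2 fC r_gt0 => x fx rx xab; rewrite /g (gtr0_norm (rx xab)) min_l//.
  rewrite ler_pXn2r ?nnegrE//; first exact: fx.
  by case: (f x) => x1 x2; exact: sqrtr_ge0.
have gC x : g x <= C ^+ 2 * `|r x| by rewrite ler_wpM2r// ge_min lexx orbT.
apply: le_Rintegral => //; apply: le_integrable ri => //.
  exact/measurable_EFinP.
move=> x _; rewrite lee_fin ger0_norm ?(le_trans (gC x) (ler_norm _))//.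
by rewrite mulr_ge0// le_min !sqr_ge0.
Qed.

(** Since [2 |t| <= 1 + t ^+ 2], the product [r h] is dominated by [|r|] plus the weighted square of
    [h], both integrable. *)
Lemma L1_weight_mul h : inL2r a b r h ->
  L1 a b (fun x => r x * Re (h x)) /\ L1 a b (fun x => r x * Im (h x)).
Proof.
move=> /inL2rP[[mRe mIm] hi].
have Hi : inL1 a b (fun x => `|r x| + `|weighted_sqr_norm h x|).
  by apply: L1_inL1; apply: L1D; apply: L1_norm; exact: inL1_L1.
have le x (t : R) : t ^+ 2 <= Normc.normc (h x) ^+ 2 ->
    `|r x * t| <= `|r x| + `|weighted_sqr_norm h x|.
  move=> ht; rewrite /weighted_sqr_norm normrM [X in _ + X]normrM -[X in X + _]mul1r -mulrDl mulrC.
  apply: ler_wpM2r => //; rewrite [X in _ + X]ger0_norm ?sqr_ge0//.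
  apply: le_trans (lerD (lexx 1) ht); rewrite -real_normK ?num_real//.
  have := sqr_ge0 (`|t| - 1); rewrite sqrrB expr1n mulr1; nra.
split; apply: inL1_L1; apply: le_integrable Hi => //.
- by apply/measurable_EFinP; apply: measurable_funM => //; exact: measurable_weight.
- move=> x _; rewrite /= lee_fin (le_trans _ (ler_norm _))//; apply: le.
  by rewrite normc_sqr lerDl sqr_ge0.
- by apply/measurable_EFinP; apply: measurable_funM => //; exact: measurable_weight.
- move=> x _; rewrite /= lee_fin (le_trans _ (ler_norm _))//; apply: le.
  by rewrite normc_sqr lerDr sqr_ge0.
Qed.

(* By |x| <= x^2 + 1/4. *)
Lemma integral_weight_mul_le h : inL2r a b r h -> L2r_norm a b r h <= 1 ->
  integral_to a (fun x => `|r x * Re (h x)|) b +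
  integral_to a (fun x => `|r x * Im (h x)|) b <= 1 + integral_to a (fun x => `|r x|) b.
Proof.
move=> h2 hn; have [rRe rIm] := L1_weight_mul h2.
move: h2 => /inL2rP[mh hi].
have n1 : \int[mu]_(x in `]a, b[) (weighted_sqr_norm h x) <= 1.
  by move: hn; rewrite /L2r_norm -[leRHS]sqrtr1 ler_sqrt.
have n2 : integral_to a (fun x => `|weighted_sqr_norm h x|) b <= 1.
  apply: le_trans n1; rewrite -Rintegral_itvoo; last first.
    by apply: L1_inL1; apply: L1_norm; exact: inL1_L1.
  rewrite (@eq_Rintegral_itvoo (fun x => `|weighted_sqr_norm h x|) (weighted_sqr_norm h))//.
  - apply: ae_mono r_gt0 => x rx xab; rewrite ger0_norm// mulr_ge0 ?sqr_ge0//.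
    exact/ltW/rx.
  - by apply: measurableT_comp => //; exact: measurable_weighted_sqr_norm.
  - exact: measurable_weighted_sqr_norm.
rewrite -(@integral_toD _ a b) ?lexx//; [|exact: L1_norm..].
apply: (@le_trans _ _ (integral_to a (fun x => `|weighted_sqr_norm h x| + `|r x|) b)); last first.
  rewrite (@integral_toD _ a b) ?lexx//; [|apply: L1_norm; exact: inL1_L1..].
  by rewrite lerD2r.
apply: (@le_integral_to _ a b) => //.
- by apply: L1D; exact: L1_norm.
- by apply: L1D; apply: L1_norm; exact: inL1_L1.
move=> t _ _; rewrite /weighted_sqr_norm !(normrM (r t)) -mulrDr (normrM (_ ^+ 2)).
rewrite -[X in _ <= _ + X]mul1r -mulrDl [leLHS]mulrC.
apply: ler_wpM2r => //; rewrite [`|_ ^+ 2|]ger0_norm ?sqr_ge0// normc_sqr.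
rewrite -(real_normK (num_real (Re _))) -(real_normK (num_real (Im _))).
set x := `|Re _|; set y := `|Im _|.
have := sqr_ge0 (x - 2^-1); have := sqr_ge0 (y - 2^-1); nra.
Qed.

Lemma inL2rD f g : inL2r a b r f -> inL2r a b r g -> inL2r a b r (fun x => f x + g x).
Proof.
move=> /inL2rP[[f1 f2] fi] /inL2rP[[g1 g2] gi]; apply/inL2rP.
have mfg : re_im_measurable (fun x => f x + g x).
  split; [rewrite (_ : _ \o _ = (Re \o f) \+ (Re \o g))|
          rewrite (_ : _ \o _ = (Im \o f) \+ (Im \o g))]; do ?[exact: measurable_funD].
    by apply/funext => x /=; rewrite ReD.
  by apply/funext => x /=; rewrite ImD.
split => //.
have Hi : inL1 a b (fun x => 2 * (`|weighted_sqr_norm f x| + `|weighted_sqr_norm g x|)).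
  by apply: L1_inL1; apply: L1Z; apply: L1D; apply: L1_norm; exact: inL1_L1.
apply: le_integrable Hi => //.
  by apply/measurable_EFinP; exact: measurable_weighted_sqr_norm.
move=> x _; rewrite lee_fin; apply: le_trans (ler_norm _) => /=.
rewrite /weighted_sqr_norm !(normrM (_ ^+ 2)) -mulrDl mulrA ler_wpM2r//.
rewrite !ger0_norm ?sqr_ge0// !normc_sqr ReD ImD.
have := sqr_ge0 (Re (f x) - Re (g x)); have := sqr_ge0 (Im (f x) - Im (g x)); nra.
Qed.

Lemma inL2r_bounded f : bounded_measurable a b (Re \o f) ->
  bounded_measurable a b (Im \o f) -> inL2r a b r f.
Proof.
move=> bRe bIm; apply/inL2rP; split.
  by split; [apply: measurable_funS bRe.1|apply: measurable_funS bIm.1] => //;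
    exact: subset_itv_oo_cc.
apply: L1_inL1.
have r1 := inL1_L1 hr.
have := L1D (L1_mul bRe (L1_mul bRe r1)) (L1_mul bIm (L1_mul bIm r1)).
by apply: eq_L1 => x _ _; rewrite /weighted_sqr_norm normc_sqr /=; ring.
Qed.

End WeightedL2.

(** * The resolvent equation at ['i] as a real system of size 4 *)

Section SturmLiouvilleSystem.
Variables (a b : R) (p q r s : R -> R).
Hypotheses (ab : a < b) (hp : inL1 a b (fun x => (p x)^-1)) (hq : inL1 a b q).
Hypotheses (hr : inL1 a b r) (hs : inL1 a b s).
Hypotheses (p_gt0 : ae_pos a b p) (r_gt0 : ae_pos a b r).
Implicit Types (h f g : R -> R[i]).
Let leab : a <= b := ltW ab.

(* With g = h + 'i y, the equation g = L y reads
   y' = - s y + u / p, u' = (q - 'i r) y + s u - r h. *)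
Definition sl_coef (i j : 'I_4) (t : R) : R := nth 0 (nth [::]
  [:: [:: - s t; 0; (p t)^-1; 0];
      [:: 0; - s t; 0; (p t)^-1];
      [:: q t; r t; s t; 0];
      [:: - r t; q t; 0; s t]] i) j.

Definition sl_forcing h (i : 'I_4) (t : R) : R :=
  nth 0 [:: 0; 0; - (r t * Re (h t)); - (r t * Im (h t))] i.

Lemma L1_sl_coef i j : L1 a b (sl_coef i j).
Proof.
have L1N (f : R -> R) : L1 a b f -> L1 a b (fun t => - f t).
  by move=> /(L1Z (-1)); apply: eq_L1 => t _ _; rewrite mulN1r.
have [/= P1 Q1 R1 S1] := And4 (inL1_L1 hp) (inL1_L1 hq) (inL1_L1 hr) (inL1_L1 hs).
by rewrite /sl_coef; case: i => [[|[|[|[|//]]]] ?]; case: j => [[|[|[|[|//]]]] ?] /=;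
  rewrite ?(nth_default)//; do ?[exact: L10|exact: L1N].
Qed.

Lemma L1_sl_forcing h i : inL2r a b r h -> L1 a b (sl_forcing h i).
Proof.
move=> /(L1_weight_mul hr r_gt0)[h1 h2].
have L1N (f : R -> R) : L1 a b f -> L1 a b (fun t => - f t).
  by move=> /(L1Z (-1)); apply: eq_L1 => t _ _; rewrite mulN1r.
by rewrite /sl_forcing; case: i => [[|[|[|[|//]]]] ?] /=; do ?[exact: L10|exact: L1N].
Qed.

Lemma sl_rhsE h y u i t : rhs sl_coef (sl_forcing h) (real_vecfun y u) i t =
  nth 0 [:: - s t * Re (y t) + (p t)^-1 * Re (u t);
            - s t * Im (y t) + (p t)^-1 * Im (u t);
            q t * Re (y t) + r t * Im (y t) + s t * Re (u t) - r t * Re (h t);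
            - r t * Re (y t) + q t * Im (y t) + s t * Im (u t) - r t * Im (h t)] i.
Proof.
rewrite /rhs /sl_coef /sl_forcing /real_vecfun !big_ord_recl big_ord0.
by case: i => [[|[|[|[|//]]]] ?] /=; ring.
Qed.

Lemma ac_ae_is_derive (f : R -> R) : ac a b f ->
  {ae mu, forall x, x \in `]a, b[ -> is_derive x 1 f (derive1 f x)}.
Proof.
move=> /(ac_primitive ab)[g /(primitive_derive ab)]; apply: ae_mono => x h xab.
by have {}h := h xab; rewrite derive1E derive_val.
Qed.

Lemma quasi_derivE y u x : p x != 0 -> u x = quasi_deriv p s y x <->
  Re (cderiv y x) = - s x * Re (y x) + (p x)^-1 * Re (u x) /\
  Im (cderiv y x) = - s x * Im (y x) + (p x)^-1 * Im (u x).
Proof.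
move=> p0; rewrite /quasi_deriv; split=> [->|[h1 h2]].
  by rewrite !(ReM, ImM, ReD, ImD) /=; split; field.
by apply: eq_ReIm; rewrite !(ReM, ImM, ReD, ImD) h1 h2 /=; field.
Qed.

Lemma sl_exprE h y u x : r x != 0 ->
  h x = sl_expr q r s y u x - 'i * y x <->
  Re (cderiv u x) = q x * Re (y x) + r x * Im (y x) + s x * Re (u x) - r x * Re (h x) /\
  Im (cderiv u x) = - r x * Re (y x) + q x * Im (y x) + s x * Im (u x) - r x * Im (h x).
Proof.
move=> r0; rewrite /sl_expr; split=> [->|[h1 h2]].
  by rewrite !(ReM, ImM, ReD, ImD, ReN, ImN) /=; split; field.
by apply: eq_ReIm; rewrite !(ReM, ImM, ReD, ImD, ReN, ImN) h1 h2 /=; field.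
Qed.

(** From left to right, absolutely continuous functions with known a.e. derivatives are primitives
    of them; from right to left, primitives are differentiable a.e. Division by [p] and [r] is
    legitimate a.e. by positivity. *)
Lemma solves_sl_system h y u : inL2r a b r h ->
  [/\ abs_continuous a b y, abs_continuous a b u,
      u = quasi_deriv p s y %[ae mu in `]a, b[%classic] &
      h = (fun x => sl_expr q r s y u x - 'i * y x) %[ae mu in `]a, b[%classic]] <->
  solves a b sl_coef (sl_forcing h) (real_vecfun y u).
Proof.
move=> h2; split=> [[yac uac uE hE]|Ys].
  have [yRe yIm] := abs_continuous_ac yac; have [uRe uIm] := abs_continuous_ac uac.
  have Yac i : ac a b (real_vecfun y u i).
    by case: i => [[|[|[|[|//]]]] ?].
  have [gs Ygs] := choice (fun i => ac_primitive ab (Yac i)).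
  move=> i; apply: ac_is_derive_primitive => //.
    apply: (@L1_rhs _ a b 4 sl_coef) => //; [exact: L1_sl_coef| |].
      by move=> j; exact: L1_sl_forcing.
    by move=> j; exact: primitive_bounded_measurable (Ygs j).
  have H1 : {ae mu, forall x, x \in `]a, b[ ->
      Re (cderiv y x) = - s x * Re (y x) + (p x)^-1 * Re (u x) /\
      Im (cderiv y x) = - s x * Im (y x) + (p x)^-1 * Im (u x)}.
    by apply: ae_mono2 uE p_gt0 => x h0 p0 xab; apply/quasi_derivE;
      [rewrite gt_eqF// p0|exact: h0].
  have H2 : {ae mu, forall x, x \in `]a, b[ ->
      Re (cderiv u x) = q x * Re (y x) + r x * Im (y x) + s x * Re (u x) - r x * Re (h x) /\
      Im (cderiv u x) = - r x * Re (y x) + q x * Im (y x) + s x * Im (u x) - r x * Im (h x)}.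
    by apply: ae_mono2 hE r_gt0 => x h0 r0 xab; apply/sl_exprE;
      [rewrite gt_eqF// r0|exact: h0].
  apply: ae_mono3 (ac_ae_is_derive (Yac i)) H1 H2 => x dY H1x H2x xab.
  have {dY} := dY xab; have [e1 e2] := H1x xab; have [e3 e4] := H2x xab.
  rewrite sl_rhsE; case: i => [[|[|[|[|//]]]] ?] /=.
  - by rewrite -e1.
  - by rewrite -e2.
  - by rewrite -e3.
  - by rewrite -e4.
have Yd i : {ae mu, forall x, x \in `]a, b[ ->
    derive1 (real_vecfun y u i) x = rhs sl_coef (sl_forcing h) (real_vecfun y u) i x}.
  apply: ae_mono (primitive_derive ab (Ys i)) => x dY xab.
  by have {}dY := dY xab; rewrite derive1E derive_val.
have Y0 := Yd (@Ordinal 4 0 isT); have Y1 := Yd (@Ordinal 4 1 isT).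
have Y2 := Yd (@Ordinal 4 2 isT); have Y3 := Yd (@Ordinal 4 3 isT).
split.
- exact: primitive_abs_continuous (Ys (@Ordinal 4 0 isT)) (Ys (@Ordinal 4 1 isT)).
- exact: primitive_abs_continuous (Ys (@Ordinal 4 2 isT)) (Ys (@Ordinal 4 3 isT)).
- apply: ae_mono3 p_gt0 Y0 Y1 => x p0 e1 e2 xab.
  apply/quasi_derivE; first by rewrite gt_eqF// p0.
  by have {}e1 := e1 xab; have {}e2 := e2 xab; rewrite !sl_rhsE/= in e1 e2.
- apply: ae_mono3 r_gt0 Y2 Y3 => x r0 e1 e2 xab.
  apply/sl_exprE; first by rewrite gt_eqF// r0.
  by have {}e1 := e1 xab; have {}e2 := e2 xab; rewrite !sl_rhsE/= in e1 e2.
Qed.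

Variables (A B : 'M[R[i]]_2).
Let T := sl_operator a b p q r s A B.

Lemma real_vecfun_surj (Y : 'I_4 -> R -> R) : exists y u, Y = real_vecfun y u.
Proof.
pose o k (k4 : (k < 4)%N) := Y (Ordinal k4).
exists (fun t => o 0 isT t +i* o 1 isT t), (fun t => o 2 isT t +i* o 3 isT t).
apply/funext => i; apply/funext => t.
by case: i => [[|[|[|[|//]]]] ?]; rewrite /real_vecfun /=; congr (Y _ t); exact/val_inj.
Qed.

Lemma resolvent_solves h f : resolvent a b r T 'i (h, f) -> exists y u,
  [/\ inL2r a b r h, inL2r a b r f, f = y %[ae mu in `]a, b[%classic],
      solves a b sl_coef (sl_forcing h) (real_vecfun y u) &
      boundary a b (realmx A) (realmx B) (real_vecfun y u) = 0].
Proof.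
move=> [h2 [g [f2 g2 [y [u [[yac uac] uE bc fy gE]]]] hE]]; exists y, u; split => //.
  apply/solves_sl_system => //; split => //.
  by apply: ae_mono3 fy gE hE => x /= fx gx hx xab; rewrite hx// fx// gx.
exact/boundary_real_vecfun.
Qed.

Lemma solves_resolvent h y u : inL2r a b r h ->
  solves a b sl_coef (sl_forcing h) (real_vecfun y u) ->
  boundary a b (realmx A) (realmx B) (real_vecfun y u) = 0 ->
  resolvent a b r T 'i (h, y).
Proof.
move=> h2 Ys bY; have [yac uac uE hE] := (solves_sl_system y u h2).2 Ys.
have b0 := primitive_bounded_measurable ab (Ys (@Ordinal 4 0 isT)).
have b1 := primitive_bounded_measurable ab (Ys (@Ordinal 4 1 isT)).
have y2 : inL2r a b r y by exact: inL2r_bounded.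
have iy2 : inL2r a b r (fun x => 'i * y x).
  apply: inL2r_bounded => //.
    rewrite (_ : _ \o _ = fun x => 0 - Im (y x)).
      by apply: bounded_measurableB => //; exact: bounded_measurable_cst.
    by apply/funext => x /=; rewrite ReM /=; ring.
  rewrite (_ : _ \o _ = Re \o y)//.
  by apply/funext => x /=; rewrite ImM /=; ring.
(* The value of the operator at [y] has to be [h + 'i y]. It is in the weighted space because [h] is
   and [y], being a primitive, is bounded. *)
split => //=; exists (fun x => h x + 'i * y x); last first.
  by apply: aeW => x _ /=; rewrite addrK.
split => //=; first exact: inL2rD.
exists y, u; split => //.
- exact/boundary_real_vecfun.
- exact: aeW.
- by apply: ae_mono hE => x hx xab; rewrite hx// subrK.
Qed.

(** The first factor bounds the norm of the forcing for [h] in the unit ball; the square root is the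
    cost of passing from the sup norm to the weighted norm. *)
Definition resolvent_const : R :=
  (1 + integral_to a (fun x => `|r x|) b) * Num.sqrt (integral_to a (fun x => `|r x|) b).

Lemma L1norm_sl_forcing h : inL2r a b r h -> L2r_norm a b r h <= 1 ->
  L1norm_vec a b (sl_forcing h) <= 1 + integral_to a (fun x => `|r x|) b.
Proof.
move=> h2 hn; apply: le_trans (integral_weight_mul_le hr r_gt0 h2 hn).
rewrite /L1norm_vec !big_ord_recl big_ord0 /sl_forcing /= addr0.
have e0 : integral_to a (fun=> `|0 : R|) b = 0.
  by rewrite normr0 /integral_to /Rintegral integral0.
have eN (g : R -> R) : (fun t => `|- g t|) = (fun t => `|g t|).
  by apply/funext => t; rewrite normrN.
by rewrite e0 !add0r !(eN (fun t => r t * _)).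
Qed.

Lemma vecfun_norm_real_vecfun y u x :
  Normc.normc (y x) <= vecfun_norm (real_vecfun y u) x.
Proof.
apply: (le_trans (normc_le_ReIm _)).
rewrite /vecfun_norm !big_ord_recl big_ord0 /real_vecfun /= addr0 addrA lerDl.
by rewrite addr_ge0.
Qed.

Lemma in_resolvent_set_sl :
  uniquely_solvable a b (realmx A) (realmx B) sl_coef -> in_resolvent_set a b r T 'i.
Proof.
move=> us; split.
- move=> h h2; have Fi i := L1_sl_forcing i h2.
  have [Y [Ys bY]] := boundary_value_problem ab L1_sl_coef Fi us.
  have [y [u YE]] := real_vecfun_surj Y; rewrite YE in Ys bY.
  by exists y; exact: solves_resolvent Ys bY.
- move=> h f1 f2 /resolvent_solves[y1 [u1 [h2 _ fy1 Ys1 bY1]]].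
  move=> /resolvent_solves[y2 [u2 [_ _ fy2 Ys2 bY2]]].
  have D0 : forall i x, a <= x -> x <= b -> real_vecfun y1 u1 i x - real_vecfun y2 u2 i x = 0.
    apply: (us (fun i x => real_vecfun y1 u1 i x - real_vecfun y2 u2 i x)).
      move=> i; have := solvesB L1_sl_coef L1_sl_coef Ys1 Ys2 i.
      apply: eq_primitive_deriv => t _ _; rewrite /rhs subrr add0r.
      by rewrite [X in _ + X]big1 // => l _; rewrite subrr mul0r.
    by rewrite boundaryB bY1 bY2 subrr.
  apply: ae_mono2 fy1 fy2 => x f1x f2x xab; rewrite f1x// f2x//.
  have /andP[ax xb] : a <= x <= b by move: xab; rewrite /= in_itv/= => /andP[/ltW -> /ltW].
  apply: eq_ReIm.
    exact/eqP/(etrans (esym (subr_eq0 _ _)))/eqP/(D0 (@Ordinal 4 0 isT)).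
  exact/eqP/(etrans (esym (subr_eq0 _ _)))/eqP/(D0 (@Ordinal 4 1 isT)).
have [K K0 HK] := boundary_value_bound ab L1_sl_coef us.
apply: (@le_lt_trans _ _ (K * resolvent_const)%:E); last exact: ltry.
apply: ge_ereal_sup => _ [[h f] /= [/resolvent_solves[y [u [h2 f2 fy Ys bY]]] hn] <-].
rewrite lee_fin /resolvent_const mulrA.
have N0 : 0 <= K * (1 + integral_to a (fun x => `|r x|) b).
  by rewrite mulr_ge0// addr_ge0// integral_to_ge0.
apply: L2r_norm_ae_le => //; first by have /(inL2rP hr r_gt0)[] := f2.
apply: ae_mono fy => x fx xab; rewrite fx//.
have /andP[ax xb] : a <= x <= b by move: xab; rewrite in_itv/= => /andP[/ltW -> /ltW].
apply: (le_trans (vecfun_norm_real_vecfun y u x)).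
apply: (le_trans (HK _ _ (fun i => L1_sl_forcing i h2) Ys bY x ax xb)).
by rewrite ler_wpM2l// L1norm_sl_forcing.
Qed.

Lemma sl_forcing0 i t : sl_forcing (fun=> 0) i t = 0.
Proof.
by rewrite /sl_forcing; case: i => [[|[|[|[|//]]]] ?] /=; rewrite ?mulr0 ?oppr0.
Qed.

(* f ^+ 2 is constant, since its derivative vanishes almost everywhere. *)
Lemma ae_eq0_primitive (f g : R -> R) : primitive a b f g ->
  {ae mu, forall x, x \in `]a, b[ -> f x = 0} ->
  forall x, a <= x -> x <= b -> f x = 0.
Proof.
move=> fg f0.
have sqr_cst x : a <= x -> x <= b -> f x * f x = f a * f a.
  move=> ax xb; have P := primitiveM ab fg fg.
  have := P.2 x ax xb; rewrite /= => ->.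
  rewrite (@eq_Rintegral_ae _ _ _ _ (fun=> 0) _ _ P.1 (L10 a b) xb).
    by rewrite /Rintegral integral0 addr0.
  by apply: ae_mono f0 => t ft tab; rewrite ft// !mul0r addr0.
have [x [xab fx]] : exists x, (x \in `]a, b[) /\ f x = 0.
  apply: contrapT => nex; have N : mu.-negligible `]a, b[%classic.
    by apply: negligibleS f0 => x xab /(_ xab) fx; apply: nex; exists x.
  have : mu `]a, b[%classic = 0%E by exact: measure_negligible N.
  by rewrite lebesgue_measure_itv/= lte_fin ab => -[] /eqP; rewrite subr_eq0 gt_eqF.
have /andP[ax xb] : a <= x <= b by move: xab; rewrite in_itv/= => /andP[/ltW -> /ltW].
move=> t at1 tb; apply/eqP; rewrite -[_ == _]orbb -mulf_eq0 sqr_cst//.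
by rewrite -(sqr_cst x)// fx mulr0.
Qed.

Lemma primitive_eq0_deriv (f g : R -> R) : primitive a b f g ->
  (forall x, a <= x -> x <= b -> f x = 0) ->
  {ae mu, forall x, x \in `]a, b[ -> g x = 0}.
Proof.
move=> fg f0; apply: ae_mono (primitive_derive ab fg) => x fx xab.
have [_ <-] := fx xab; have : is_derive x 1 f 0.
  apply: (@near_eq_is_derive _ _ _ (cst 0)).
  move: xab => /near_in_itvoo; apply: filterS => t; rewrite in_itv/= => /andP[at1 tb].
  by rewrite f0// ltW.
by move=> ?; rewrite derive_val.
Qed.

(* Im (y^* u) has derivative - r |y|^2 and, by the boundary condition, the same
   value at a and b. *)
Lemma uniquely_solvable_sl : selfadjoint_bc A B ->
  uniquely_solvable a b (realmx A) (realmx B) sl_coef.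
Proof.
move=> AB Y + bY; have [y [u YE]] := real_vecfun_surj Y; rewrite YE in bY * => Ys.
have {}Ys : solves a b sl_coef (sl_forcing (fun=> 0)) (real_vecfun y u).
  by move=> i; apply: eq_primitive_deriv (Ys i) => t _ _; rewrite /rhs sl_forcing0.
have y1s := Ys (@Ordinal 4 0 isT); have y2s := Ys (@Ordinal 4 1 isT).
have u1s := Ys (@Ordinal 4 2 isT); have u2s := Ys (@Ordinal 4 3 isT).
(* The product rule for the imaginary part of the conjugate of [y] times [u]. The terms in [1 / p],
   [q] and [s] cancel because these coefficients are real; only the term in [r], produced by the
   spectral parameter ['i], remains. *)
have W := primitiveB (primitiveM ab y1s u2s) (primitiveM ab y2s u1s).
have rhsE i t : rhs sl_coef (sl_forcing (fun=> 0)) (real_vecfun y u) i t = _ :=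
  sl_rhsE (fun=> 0) y u i t.
have {}W : primitive a b (fun t => Re (y t) * Im (u t) - Im (y t) * Re (u t))
    (fun t => - (r t * (Re (y t) ^+ 2 + Im (y t) ^+ 2))).
  apply: eq_primitive_deriv W => t _ _ /=.
  by rewrite !rhsE /real_vecfun /= !mulr0 !subr0; ring.
have bc := (boundary_real_vecfun a b A B y u).1 bY.
have form := selfadjoint_bc_form AB bc.
have := congr1 (fun M : 'M[R[i]]_1 => Im (M 0 0)) form; rewrite /= !vec2_form => formE.
have := W.2 b leab (lexx b); set I := \int[mu]_(_ in _) _ => WE.
have {WE} I0 : I = 0 by lra.
rewrite {}/I in I0; set w := fun t => - (r t * _) in W I0.
have wi := L1_inL1 (L1_norm W.1).
have w0 : \int[mu]_(x in `]a, b[) `|w x| = 0.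
  rewrite (@eq_Rintegral_itvoo _ _ _ (fun t => -1 * w t)).
  - rewrite Rintegral_itvoo; last by apply: L1_inL1; apply: L1Z; exact: W.1.
    by rewrite (integral_toZ _ W.1)// /integral_to I0 mulr0.
  - apply: ae_mono r_gt0 => x r0 xab; rewrite ler0_norm ?mulN1r// oppr_le0.
    by rewrite mulr_ge0 ?addr_ge0 ?sqr_ge0// ltW// r0.
  - by have /integrableP[/measurable_EFinP] := wi.
  - apply: measurable_funM => //.
    by have /integrableP[/measurable_EFinP] := L1_inL1 W.1.
have {w0} w0 : (\int[mu]_(x in `]a, b[) `|(EFin \o w) x| = 0)%E.
  have <- : (\int[mu]_(x in `]a, b[) `|w x|)%:E = 0%E by rewrite w0.
  by rewrite /Rintegral fineK//; exact: integrable_fin_num.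
have {w0} w0 : {ae mu, forall x, x \in `]a, b[ -> w x = 0}.
  have mw : measurable_fun `]a, b[ (EFin \o w) by have /integrableP[] := L1_inL1 W.1.
  have /= := (ae_eq_integral_abs mu (measurable_itv _) mw).1 w0.
  by apply: ae_mono => x wx xab; have [] := wx xab.
have ri2 : {ae mu, forall x, x \in `]a, b[ -> Re (y x) = 0 /\ Im (y x) = 0}.
  apply: ae_mono2 w0 r_gt0 => x wx rx xab; have /eqP := wx xab.
  rewrite /w oppr_eq0 mulf_eq0 gt_eqF ?rx//= paddr_eq0 ?sqr_ge0// !sqrf_eq0.
  by move=> /andP[/eqP ? /eqP ?].
have y1_0 : forall x, a <= x -> x <= b -> Re (y x) = 0.
  by apply: (ae_eq0_primitive y1s); apply: ae_mono ri2 => x yx xab; have [] := yx xab.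
have y2_0 : forall x, a <= x -> x <= b -> Im (y x) = 0.
  by apply: (ae_eq0_primitive y2s); apply: ae_mono ri2 => x yx xab; have [] := yx xab.
(* Once [y] vanishes, so does its derivative, and the first two equations leave [u / p = 0] a.e.;
   positivity of [p] then removes [u]. *)
have pinv x (t : R) : 0 < p x -> (p x)^-1 * t = 0 -> t = 0.
  by move=> p0 /eqP; rewrite mulf_eq0 invr_eq0 gt_eqF// => /eqP.
have u1_0 : forall x, a <= x -> x <= b -> Re (u x) = 0.
  apply: (ae_eq0_primitive u1s); apply: ae_mono2 (primitive_eq0_deriv y1s y1_0) p_gt0.
  move=> x dx px xab; have := dx xab; rewrite rhsE /= y1_0; last 2 first.
    by move: xab; rewrite in_itv/= => /andP[/ltW].
    by move: xab; rewrite in_itv/= => /andP[_ /ltW].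
  by rewrite mulr0 add0r; exact/pinv/px.
have u2_0 : forall x, a <= x -> x <= b -> Im (u x) = 0.
  apply: (ae_eq0_primitive u2s); apply: ae_mono2 (primitive_eq0_deriv y2s y2_0) p_gt0.
  move=> x dx px xab; have := dx xab; rewrite rhsE /= y2_0; last 2 first.
    by move: xab; rewrite in_itv/= => /andP[/ltW].
    by move: xab; rewrite in_itv/= => /andP[_ /ltW].
  by rewrite mulr0 add0r; exact/pinv/px.
move=> i x ax xb; rewrite /real_vecfun.
by case: i => [[|[|[|[|//]]]] ?] /=; rewrite ?(y1_0, y2_0, u1_0, u2_0).
Qed.

End SturmLiouvilleSystem.

(** * Dependence on the coefficients *)

Lemma L1norm_integral_to a b (f : R -> R) : inL1 a b f ->
  L1norm a b f = (integral_to a (fun x => `|f x|) b)%:E.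
Proof.
move=> fi; have nfi := integrable_norm fi.
rewrite -(Rintegral_itvoo (g := fun x => `|f x|)); last exact: nfi.
rewrite /L1norm /Rintegral fineK//; exact: integrable_fin_num.
Qed.

Lemma L1norm_cvg0 a b (f : nat -> R -> R) : (forall m, inL1 a b (f m)) ->
  L1norm a b (f m) @[m --> \oo] --> (0 : \bar R)%E ->
  integral_to a (fun x => `|f m x|) b @[m --> \oo] --> (0 : R).
Proof.
move=> fi; under eq_fun do rewrite L1norm_integral_to//.
by move=> /fine_cvgP[].
Qed.

(** The constants count entries of the real 4 by 4 matrix: [1 / p] and [q] occur twice each, [s]
    four times up to sign. The entries in the common weight [r] cancel. *)
Lemma sl_coef_distE a b (p q r s p' q' s' : R -> R) : a < b ->
  L1 a b (fun x => (p x)^-1) -> L1 a b q -> L1 a b s ->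
  L1 a b (fun x => (p' x)^-1) -> L1 a b q' -> L1 a b s' ->
  integral_to a (mxfun_norm (fun i j t =>
    sl_coef p q r s i j t - sl_coef p' q' r s' i j t)) b =
  2 * integral_to a (fun x => `|(p' x)^-1 - (p x)^-1|) b +
  2 * integral_to a (fun x => `|q' x - q x|) b +
  4 * integral_to a (fun x => `|s' x - s x|) b.
Proof.
move=> ab pi qi si p'i q'i s'i.
have dp := L1_norm (L1B p'i pi); have dq := L1_norm (L1B q'i qi).
have ds := L1_norm (L1B s'i si).
rewrite -(integral_toZ 2 dp (lexx b)) -(integral_toZ 2 dq (lexx b)).
rewrite -(integral_toZ 4 ds (lexx b)) -(@integral_toD _ a b) ?lexx//; [|exact: L1Z..].
rewrite -(@integral_toD _ a b) ?lexx//; [|by apply: L1D; exact: L1Z|exact: L1Z].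
apply: (@eq_integral_to _ a b) => // t _ _.
rewrite /mxfun_norm /sl_coef !big_ord_recl !big_ord0 /= !subrr !normr0.
rewrite ![`|- s t - _|]distrC ![`|_^-1 - (p' t)^-1|]distrC ![`|q t - _|]distrC.
rewrite ![`|s t - _|]distrC (_ : - s' t - - s t = - (s' t - s t)); last by ring.
by rewrite normrN; ring.
Qed.

(** An [opnorm] is a supremum of nonnegative numbers, but over an empty set it would be [-oo].
    Surjectivity at [h = 0] for both operators provides a member. *)
Lemma opnorm_resolvent_sub_ge0 a b (r : R -> R) (S T : graph) (z : R[i]) :
  inL1 a b r -> ae_pos a b r -> in_resolvent_set a b r S z -> in_resolvent_set a b r T z ->
  (0 <= opnorm a b r (graph_sub (resolvent a b r S z) (resolvent a b r T z)))%E.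
Proof.
move=> hr r_gt0 [exS _ _] [exT _ _].
have c0 : bounded_measurable a b (fun=> 0 : R) := bounded_measurable_cst a b 0.
have h0 : inL2r a b r (fun=> 0) by exact: inL2r_bounded.
have [f hf] := exS _ h0; have [g hg] := exT _ h0.
apply: (@le_trans _ _ (L2r_norm a b r (f \- g))%:E); first by rewrite lee_fin sqrtr_ge0.
apply: ereal_sup_ubound; exists (fun=> 0, f \- g) => //=; split.
  by exists f, g.
have /(inL2rP hr r_gt0)[m0 _] := h0.
apply: le_trans ler01; apply: (le_trans (L2r_norm_ae_le hr r_gt0 m0 (lexx 0) _)).
  by apply: aeW => x _ /=; rewrite expr0n/= addr0 sqrtr0.
by rewrite mul0r.
Qed.

Section perturbed_resolvent.
Variables (a b : R) (p q r s p' q' s' : R -> R) (A B : 'M[R[i]]_2).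
Hypotheses (ab : a < b) (hr : inL1 a b r) (r_gt0 : ae_pos a b r).
Hypotheses (hp : inL1 a b (fun x => (p x)^-1)) (hq : inL1 a b q) (hs : inL1 a b s).
Hypotheses (hp' : inL1 a b (fun x => (p' x)^-1)) (hq' : inL1 a b q') (hs' : inL1 a b s').
Hypotheses (p_gt0 : ae_pos a b p) (p'_gt0 : ae_pos a b p').
Variable K : R.
Hypothesis K0 : 0 <= K.
Hypothesis HK : forall F Y, (forall i, L1 a b (F i)) -> solves a b (sl_coef p q r s) F Y ->
  boundary a b (realmx A) (realmx B) Y = 0 ->
  forall x, a <= x -> x <= b -> vecfun_norm Y x <= K * L1norm_vec a b F.
Let eps := integral_to a (mxfun_norm (fun i j t =>
  sl_coef p q r s i j t - sl_coef p' q' r s' i j t)) b.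
Hypothesis Keps : K * eps <= 2^-1.

Let Ci i j : L1 a b (sl_coef p q r s i j).
Proof. exact: L1_sl_coef. Qed.

Let C'i i j : L1 a b (sl_coef p' q' r s' i j).
Proof. exact: L1_sl_coef. Qed.

Lemma eps_ge0 : 0 <= eps.
Proof. by apply: integral_to_ge0 => t; exact: mxfun_norm_ge0. Qed.

Lemma in_resolvent_set_perturbed :
  in_resolvent_set a b r (sl_operator a b p' q' r s' A B) 'i.
Proof.
apply: in_resolvent_set_sl => //.
exact: (uniquely_solvable_perturbation ab Ci C'i K0 HK Keps).
Qed.

Lemma opnorm_resolvent_sub_le :
  (opnorm a b r (graph_sub (resolvent a b r (sl_operator a b p' q' r s' A B) 'i)
    (resolvent a b r (sl_operator a b p q r s A B) 'i)) <=
  (2 * (K * eps * (K * resolvent_const a b r)))%:E)%E.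
Proof.
apply: ge_ereal_sup => _ [[h k] /= [[f [g [/= hf hg ->]]] hn] <-].
have [y' [u' [h2 f2 fy' Ys' bY']]] := resolvent_solves ab hp' hq' hr hs' p'_gt0 r_gt0 hf.
have [y [u [_ g2 gy Ys bY]]] := resolvent_solves ab hp hq hr hs p_gt0 r_gt0 hg.
have I0 : 0 <= integral_to a (fun x => `|r x|) b by exact: integral_to_ge0.
have -> : 2 * (K * eps * (K * resolvent_const a b r)) =
    2 * (K * eps * (K * (1 + integral_to a (fun x => `|r x|) b))) *
    Num.sqrt (integral_to a (fun x => `|r x|) b) by rewrite /resolvent_const; ring.
have C0 : 0 <= 2 * (K * eps * (K * (1 + integral_to a (fun x => `|r x|) b))).
  by rewrite !mulr_ge0 ?eps_ge0// addr_ge0.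
rewrite lee_fin; apply: L2r_norm_ae_le => //.
  have /(inL2rP hr r_gt0)[[f1 f3] _] := f2; have /(inL2rP hr r_gt0)[[g1 g3] _] := g2.
  split; [rewrite (_ : _ \o _ = (Re \o f) \- (Re \o g))|
          rewrite (_ : _ \o _ = (Im \o f) \- (Im \o g))]; do ?[exact: measurable_funB].
    by apply/funext => x /=; rewrite ReB.
  by apply/funext => x /=; rewrite ImB.
apply: ae_mono2 fy' gy => x fx gx xab.
have /andP[ax xb] : a <= x <= b by move: xab; rewrite in_itv/= => /andP[/ltW -> /ltW].
rewrite /= fx// gx//.
have D := boundary_value_perturbation ab Ci C'i K0 HK Keps
  (fun i => L1_sl_forcing hr r_gt0 i h2) Ys bY Ys' bY' ax xb.
apply: (le_trans (vecfun_norm_real_vecfun (fun t => y' t - y t) (fun t => u' t - u t) x)).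
have -> : vecfun_norm (real_vecfun (fun t => y' t - y t) (fun t => u' t - u t)) x =
    vecfun_norm (fun i t => real_vecfun y u i t - real_vecfun y' u' i t) x.
  rewrite /vecfun_norm; apply: eq_bigr => i _; rewrite /real_vecfun [RHS]distrC.
  by case: i => [[|[|[|[|//]]]] ?] /=; rewrite ?ReB ?ImB.
apply: (le_trans D); rewrite ler_wpM2l// ler_wpM2l ?mulr_ge0 ?eps_ge0// ler_wpM2l//.
exact: L1norm_sl_forcing.
Qed.

End perturbed_resolvent.
End SturmLiouvilleOperators.
Theorem lemma1p9 (R : realType) (a b : R) (p q r s : R -> R)
    (p_ q_ s_ : nat -> R -> R) (A B : 'M[R[i]]_2)
    (ab : a < b)
    (hp : inL1 a b (fun x => (p x)^-1)) (hq : inL1 a b q)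
    (hr : inL1 a b r) (hs : inL1 a b s)
    (p_gt0 : ae_pos a b p) (r_gt0 : ae_pos a b r)
    (hp_ : forall m, inL1 a b (fun x => (p_ m x)^-1))
    (hq_ : forall m, inL1 a b (q_ m))
    (hs_ : forall m, inL1 a b (s_ m))
    (p__gt0 : forall m, ae_pos a b (p_ m))
    (hAB : selfadjoint_bc A B)
    (cvg_p : L1norm a b (fun x => (p_ m x)^-1 - (p x)^-1)
               @[m --> \oo] --> (0 : \bar R)%E)
    (cvg_q : L1norm a b (fun x => q_ m x - q x)
               @[m --> \oo] --> (0 : \bar R)%E)
    (cvg_s : L1norm a b (fun x => s_ m x - s x)
               @[m --> \oo] --> (0 : \bar R)%E) :
  norm_resolvent_cvg a b r
    (fun m => sl_operator a b (p_ m) (q_ m) r (s_ m) A B)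
    (sl_operator a b p q r s A B).
Proof.
have us := uniquely_solvable_sl (q := q) (s := s) ab p_gt0 r_gt0 hAB.
have rs := in_resolvent_set_sl ab hp hq hr hs p_gt0 r_gt0 us.
have [K K0 HK] := boundary_value_bound ab (L1_sl_coef hp hq hr hs) us.
pose eps m := integral_to a (mxfun_norm (fun i j t =>
  sl_coef p q r s i j t - sl_coef (p_ m) (q_ m) r (s_ m) i j t)) b.
have cvgB (c : R) (f : R -> R) (f_ : nat -> R -> R) :
    inL1 a b f -> (forall m, inL1 a b (f_ m)) ->
    L1norm a b (fun x => f_ m x - f x) @[m --> \oo] --> (0 : \bar R)%E ->
    c * integral_to a (fun x => `|f_ m x - f x|) b @[m --> \oo] --> (0 : R).
  move=> fi fi_ cf; rewrite -[0](mulr0 c); apply: cvgMr.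
  apply: (@L1norm_cvg0 _ _ _ (fun m x => f_ m x - f x)) => // m.
  by apply: L1_inL1; apply: L1B; exact: inL1_L1.
have epsE : eps = fun m => 2 * integral_to a (fun x => `|(p_ m x)^-1 - (p x)^-1|) b +
    2 * integral_to a (fun x => `|q_ m x - q x|) b +
    4 * integral_to a (fun x => `|s_ m x - s x|) b.
  by apply/funext => m; apply: sl_coef_distE => //; exact: inL1_L1.
have eps0 : eps m @[m --> \oo] --> (0 : R).
  rewrite epsE (_ : (0 : R) = 0 + 0 + 0); last by rewrite !addr0.
  apply: cvgD; last exact: cvgB hs hs_ cvg_s.
  by apply: cvgD; [exact: cvgB hp hp_ cvg_p|exact: cvgB hq hq_ cvg_q].
have Keps : \forall m \near \oo, K * eps m <= 2^-1.
  have : K * eps m @[m --> \oo] --> (0 : R) by rewrite -[0](mulr0 K); exact: cvgMr.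
  move=> /cvgrPdist_le/(_ 2^-1); rewrite invr_gt0 ltr0n => /(_ isT).
  by apply: filterS => m; rewrite sub0r normrN; exact/le_trans/ler_norm.
have rs_ : \forall m \near \oo,
    in_resolvent_set a b r (sl_operator a b (p_ m) (q_ m) r (s_ m) A B) ('i)%C.
  by apply: filterS Keps => m; apply: in_resolvent_set_perturbed HK.
exists ('i)%C; split => //.
(* The upper bound is linear in [eps m], because [K] was fixed from the limit operator alone. The
   lower bound 0 relies on ['i] lying in both resolvent sets, which is why [rs_] accompanies
   [Keps]. *)
apply: (@squeeze_cvge _ _ _ _ (fun=> 0%E) _
  (fun m => (2 * (K * eps m * (K * resolvent_const a b r)))%:E)).
- apply: filterS2 Keps rs_ => m Km rm; apply/andP; split.
    exact: opnorm_resolvent_sub_ge0.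
  exact: opnorm_resolvent_sub_le HK _.
- exact: cvg_cst.
apply: cvg_EFin; first exact: nearW.
rewrite -[0](mulr0 2); apply: cvgMr.
rewrite -[0](mul0r (K * resolvent_const a b r)); apply: cvgMl.
by rewrite -[0](mulr0 K); exact: cvgMr.
Qed.
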